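(* Consider the following two assertions. **Assertion A.** Let $a,b\in\mathbb{Z}_{>0}$ be relatively prime with $2\le a<b$. Suppose that $F,G\in\mathbb{C}[x,y]$ satisfy: (1) $[F,G]\in\mathbb{C}$; (2) $\{(0,0),(0,1),(1,0)\}\subset N(F)$, and $N(F)$ is similar to $N(G)$ with the origin as center of similarity and with ratio $\deg(F):\deg(G)=a:b$. Then $[F,G]=0$. **Assertion B.** Let $(a,b,m,n)\in\mathcal{Q}$. Suppose that $F,G\in\mathbb{C}[x,y]$ satisfy: (1) $N^0(F)=T_{m,n}$ and $N^0(F-x^my^n)\subsetneq N^0(F)$; (2) $F^{(0,1)}_{n-i}$ is divisible by $(x+1)^{m-i}$ for $0\le i\le m$; (3) $F^{(1,1)}_{m+n-i}$ is divisible by $(x+y)^{n-i}$ for $0\le i\le n$; (4) $N^0(G)=T_{bm/a,bn/a}$ and $N^0(G-x^{bm/a}y^{bn/a})\subsetneq N^0(G)$; (5) $[F,G]\in\mathbb{C}$. Then $[F,G]=0$. If Assertion B is true, then Assertion A is true.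
   Context: For $f,g\in\mathbb{C}[x,y]$, $[f,g]=\frac{\partial f}{\partial x}\frac{\partial g}{\partial y}-\frac{\partial g}{\partial x}\frac{\partial f}{\partial y}$. $\deg$ denotes total degree. For $f=\sum f_{ij}x^iy^j\in\mathbb{C}[x,y]$, $\mathrm{supp}(f)=\{(i,j):f_{ij}\neq0\}\subset\mathbb{R}^2$; $N(f)$ is the convex hull of $\mathrm{supp}(f)$; for $f\ne0$, $N^0(f)$ is the convex hull of $\mathrm{supp}(f)\cup\{(0,0)\}$, and $N^0(0)=\emptyset$. For integers $m,n$, $T_{m,n}=\{(x,y)\in\mathbb{R}^2: 0\le y\le n,\ 0\le x\le m+n-y\}$. $\mathcal{Q}=\{(a,b,m,n)\in\mathbb{Z}_{>0}^4: m<n,\ a\mid m,\ a\mid n,\ \gcd(a,b)=1,\ 2\le a<b\}$. For $f\in\mathbb{C}[x,y]$ and $j\in\mathbb{Z}$, $f^{(0,1)}_j$ is the sum of the terms of $f$ of $y$-degree $j$ and $f^{(1,1)}_j$ is the sum of the terms of $f$ of total degree $j$. *)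

(* Defs.v *)
From HB Require Import structures.
From mathcomp Require Import all_boot all_order all_algebra.
From mathcomp Require Import classical_sets reals convex.
From mathcomp Require Import complex mpoly.

Set Implicit Arguments.
Unset Strict Implicit.
Unset Printing Implicit Defensive.

Import Order.TTheory GRing.Theory Num.Theory.

Local Open Scope classical_set_scope.
Local Open Scope ring_scope.
Local Open Scope complex_scope.

Definition ydeg (k : 'X_{1..2}) : nat := k 1.

Fact ydeg0 : ydeg 0%MM = 0%N.
Proof. by rewrite /ydeg mnm0E. Qed.

Fact ydegD : {morph ydeg : k l / (k + l)%MM >-> (k + l)%N}.
Proof. by move=> k l; rewrite /ydeg mnmDE. Qed.

HB.instance Definition _ := isMeasure.Build 2 ydeg ydeg0 ydegD.

Section Polygons.
Context (R : realType).

Notation plane := (R^o * R^o)%type.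

(* C[x, y] with x = 'X_0 and y = 'X_1 *)
Notation poly2 := {mpoly R[i][2]}.

Implicit Types (f g : poly2) (A : set plane).

Definition jac f g : poly2 := f^`M(0) * g^`M(1) - g^`M(0) * f^`M(1).

(* total degree; msize is one more, except that both are 0 at f = 0 *)
Definition tdeg f : nat := (msize f).-1.

Definition part01 (j : nat) f : poly2 := pihomog ydeg j f.

Definition part11 (j : nat) f : poly2 := pihomog mdeg j f.

Definition divides f g : Prop := exists h, g = h * f.

Definition conv_hull A : set plane := smallest (@convex_set R plane) A.

Definition lattice_pt (i j : nat) : plane := (i%:R, j%:R).

Definition supp f : set plane :=
  [set lattice_pt (k 0) (k 1) | k in [set` msupp f]].

Definition newton f : set plane := conv_hull (supp f).

Definition newton0 f : set plane :=
  if f == 0 then set0 else conv_hull (supp f `|` [set lattice_pt 0 0]).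

(* B is the image of A under the homothety of center the origin and ratio
   s / r, so that lengths in A are to lengths in B as r : s *)
Definition similar0 (r s : nat) A (B : set plane) : Prop :=
  B = [set (s%:R / r%:R : R) *: p | p in A].

Definition trapezoid (m n : int) : set plane :=
  [set p | 0 <= p.2 <= n%:~R /\ 0 <= p.1 <= (m + n)%:~R - p.2].

End Polygons.

Definition inQ (a b m n : nat) : Prop :=
  [/\ [&& 0 < a, 0 < b, 0 < m & 0 < n]%N, (m < n)%N,
      (a %| m)%N /\ (a %| n)%N, coprime a b & (2 <= a < b)%N].

Definition assertionA (R : realType) : Prop :=
  forall a b : nat, (0 < a)%N -> (0 < b)%N -> coprime a b -> (2 <= a < b)%N ->
  forall F G : {mpoly R[i][2]},
    (exists c : R[i], jac F G = c%:MP) ->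
    [set lattice_pt R 0 0; lattice_pt R 0 1; lattice_pt R 1 0]
      `<=` newton F ->
    similar0 (tdeg F) (tdeg G) (newton F) (newton G) ->
    (tdeg F * b = tdeg G * a)%N ->
    jac F G = 0.

(* m < n and a divides m and n, so the subtractions and divisions of natural
   numbers below are exact. *)
Definition assertionB (R : realType) : Prop :=
  forall a b m n : nat, inQ a b m n ->
  forall F G : {mpoly R[i][2]},
    newton0 F = trapezoid m n ->
    newton0 (F - 'X_0 ^+ m * 'X_1 ^+ n) `<` newton0 F ->
    (forall i : nat, (i <= m)%N ->
       divides (('X_0 + 1) ^+ (m - i)) (part01 (n - i) F)) ->
    (forall i : nat, (i <= n)%N ->
       divides (('X_0 + 'X_1) ^+ (n - i)) (part11 (m + n - i) F)) ->
    newton0 G = trapezoid (b * m %/ a)%N (b * n %/ a)%N ->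
    newton0 (G - 'X_0 ^+ (b * m %/ a) * 'X_1 ^+ (b * n %/ a)) `<` newton0 G ->
    (exists c : R[i], jac F G = c%:MP) ->
    jac F G = 0.

(* Main.v *)
Require Import Defs.
From HB Require Import structures.
From mathcomp Require Import all_boot all_order all_algebra.
From mathcomp Require Import classical_sets reals convex interval_inference.
From mathcomp Require Import boolp complex.
From mathcomp Require Import mpoly.
From mathcomp Require Import zify ring lra.

(** Suppose that [F, G] is a nonzero constant and that the degrees of F and G
are as a to b. Automorphisms of the plane and rescalings multiply [F, G] by a
nonzero constant, and they are used here to turn (F, G) into a pair with the
properties listed in assertion B. As B makes the bracket of that pair vanish,
this is a contradiction.

The main tool describes leading forms. Fix a weight w = (s, t) with t > 0 and
s + t > 0, let D > 0 be the weight of F, and let f(x) be the value at y = 1 of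
the part of F of weight D. If (s + t) deg f < 2 D, then f is a constant times a
power of some x - rho ([leading_form_power]). The reason is as follows. At
y = 1 the bracket of homogeneous forms h, k of weights e, e' becomes
e' h' k - e h k', up to the factor t ([lead_bracket]). In each weight the forms
that commute with f make up a line, whereas the dimension of the part of weight
at most N of K[F, G] grows at least like N^2; so some Q in K[F, G] has a leading
form q that does not commute with f ([exists_noncommuting]). Choose Q of least
degree in G. Then [F, Q], which is a constant times the derivative of Q with
respect to G, has a leading form r that does commute with f, and phi = f q / r
solves

    (s + t) f' phi - D f phi' = f      ([leading_eigenvector]).

Comparing orders at a pole shows that phi is a polynomial ([phi_polynomial]);
comparing them at a root of f shows that phi vanishes there ([ode_root]);
comparing top coefficients shows that deg phi = 1 ([ode_solution]). So f has at
most one root. The leading form of G commutes with that of F, hence it is a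
power of the same linear form, the exponents being as a to b ([edge_powers]).
If one of the two leading forms is not a monomial, then rho <> 0, which forces
s = k t for an integer k, and if k >= 0 the automorphism x -> x + rho y^k turns
both leading forms into monomials ([edge_step]).

This is used to simplify F and G edge by edge. For the weight (1, 1), a linear
change of variables makes the leading form of F a monomial x^m y^j with m <> j
and j > 0 ([two_points]). If m = 0, the next edge has the direction of a weight
(k, 1) with k >= 2 ([steep_case]); straightening it, and then the edges between
(k, 1) and (1, 1), gives a pair of smaller degree in the same ratio
([descent]), and one concludes by induction. Otherwise one may swap x and y to
have 0 < m < j =: n. Turning the weight from (1, 1) to (1, 0) no edge is met
([right_bounded]), and turning it to (-1, 1) only a horizontal one, which a
translation of x removes ([left_bounded]). Hence the exponents (p, q) of F
satisfy p <= m and q - p <= n - m, and similarly for G ([reduction]).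

Finally, replace (x, y) by (x + 1, x + y). The exponents being bounded as above,
the coefficient of y^n becomes (x + 1)^m and the top form x^m (x + y)^n, which
gives the trapezoid ([newton0_hat]); a monomial x^p y^q goes to
(x + 1)^p (x + y)^q, which gives the two divisibility conditions
([part01_hat], [part11_hat]). *)

Set Implicit Arguments.
Unset Strict Implicit.
Unset Printing Implicit Defensive.

Import Order.TTheory GRing.Theory Num.Theory.

Local Open Scope ring_scope.

(** * Univariate polynomials *)

Section Univariate.
Variable K : numClosedFieldType.
Implicit Types p q f g r u v phi : {poly K}.

Lemma coef_mul_top p q m n : (size p <= m.+1)%N -> (size q <= n.+1)%N ->
  (p * q)`_(m + n) = p`_m * q`_n.
Proof.
move=> sp sq; rewrite coefM (bigD1 (inord m)) //= inordK ?ltnS ?leq_addr //.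
rewrite addKn big1 ?addr0 // => i ni.
have [lt|gt|e] := ltngtP (val i) m.
- have h : (size q <= m + n - i)%N by move: sq lt => /=; lia.
  by rewrite (nth_default _ h) mulr0.
- have h : (size p <= i)%N by exact: leq_trans sp gt.
  by rewrite (nth_default _ h) mul0r.
by case/eqP: ni; apply: val_inj; rewrite /= inordK // -?e ltnS leq_addr.
Qed.

Lemma coefXderiv p i : ('X * p^`())`_i = p`_i *+ i.
Proof. by rewrite coefXM; case: i => [|i] /=; rewrite ?mulr0n // coef_deriv. Qed.

Lemma size_Xderiv p : (size ('X * p^`())%R <= size p)%N.
Proof.
by apply/leq_sizeP => j lj; rewrite coefXderiv nth_default // mul0rn.
Qed.

(** The operator X d/dX multiplies the top coefficient by the degree, so the
equation, multiplied by X, compares degrees. *)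
Lemma top_relation (e1 e2 : K) p q : p != 0 -> q != 0 ->
  e1%:P * (p^`() * q) = e2%:P * (p * q^`()) ->
  e1 * (size p).-1%:R = e2 * (size q).-1%:R.
Proof.
move=> p0 q0 eq.
have [sp sq] : size p = (size p).-1.+1 /\ size q = (size q).-1.+1.
  by rewrite !prednK // size_poly_gt0.
have /(congr1 (fun s : {poly K} => s`_((size p).-1 + (size q).-1))) :
  e1%:P * (('X * p^`()) * q) = e2%:P * (p * ('X * q^`())).
  transitivity ('X * (e1%:P * (p^`() * q))); first by ring.
  by rewrite eq; ring.
rewrite !coefCM !coef_mul_top -?sp -?sq ?size_Xderiv // !coefXderiv.
rewrite -!lead_coefE -[_ *+ _ in LHS]mulr_natr -[_ *+ _ in RHS]mulr_natr => eq2.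
have l0 : lead_coef p * lead_coef q != 0.
  by rewrite mulf_neq0 ?lead_coef_eq0.
apply: (mulfI l0).
transitivity (e1 * (lead_coef p * (size p).-1%:R * lead_coef q)); first by ring.
by rewrite eq2; ring.
Qed.

Lemma deriv_eq0 p : p^`() = 0 -> p = (p`_0)%:P.
Proof.
move=> p'0; apply/polyP => -[|i]; rewrite coefC //=.
have /eqP := congr1 (fun s : {poly K} => s`_i) p'0.
by rewrite coef_deriv coef0 mulrn_eq0 /= => /eqP.
Qed.

(** Subtract from q the multiple of p that kills the coefficient of degree
deg p. The remainder satisfies the same equation, so it has the degree of p by
[top_relation] unless it is 0. *)
Lemma wronskian_prop p q : p != 0 -> p^`() * q = p * q^`() ->
  exists c, q = c%:P * p.
Proof.
move=> p0 pq; exists (q`_(size p).-1 / lead_coef p).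
set c := _ / _; apply/eqP; rewrite -subr_eq0; apply/negPn/negP => r0.
set r := q - _ in r0.
have : 1%:P * (p^`() * r) = 1%:P * (p * r^`()).
  by rewrite /r derivB derivM derivC mul0r add0r !mulrBr pq; ring.
move/(top_relation p0 r0); rewrite !mul1r => /eqP; rewrite eqr_nat => /eqP e.
have := lead_coef_eq0 r; rewrite (negPf r0) lead_coefE -e /r coefB coefCM.
by rewrite -lead_coefE divfK ?lead_coef_eq0 // subrr eqxx.
Qed.

(** Multiplying the derivative by X - a keeps the power of X - a as a factor;
this avoids the exponent m - 1. *)
Lemma XsubC_deriv (a : K) m g :
  ('X - a%:P) * (('X - a%:P) ^+ m * g)^`() =
  ('X - a%:P) ^+ m * (m%:R%:P * g + ('X - a%:P) * g^`()).
Proof.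
rewrite derivM deriv_exp derivXsubC mul1r -mulr_natr.
case: m => [|m] /=; first by rewrite expr0 mulr0 mul0r; ring.
by rewrite exprS; ring.
Qed.

Lemma root_factor p a : p != 0 ->
  exists m g, p = ('X - a%:P) ^+ m * g /\ g.[a] != 0.
Proof.
move=> p0; have [m [g]] := multiplicity_XsubC p a.
by rewrite p0 /= => ga ->; exists m, g; rewrite mulrC.
Qed.

(** For phi = u / v the hypothesis says A f' phi - D f phi' = f. Divided by the
powers of X - a that occur in f and v, and multiplied by X - a, the equation can
be evaluated at a, and only the multiplicities k of f and m of v survive. *)
Lemma ode_local (A D : K) f u v a : f != 0 -> v != 0 ->
  A%:P * (f^`() * (u * v)) - D%:P * (f * (u^`() * v - u * v^`())) =
    f * v ^+ 2 ->
  exists k m, A * k%:R * u.[a] + D * m%:R * u.[a] = 0 /\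
    (k = 0%N -> f.[a] != 0) /\ (m = 0%N -> v.[a] != 0).
Proof.
move=> f0 v0 ode.
have [k [f1 [ef f1a]]] := root_factor a f0.
have [m [v1 [ev v1a]]] := root_factor a v0.
exists k, m; split; last first.
  split=> e; [move: f1a | move: v1a]; by rewrite ?ef ?ev e expr0 mul1r.
set P := 'X - a%:P in ef ev *.
have P0 : P != 0 by rewrite polyXsubC_eq0.
have odeP : A%:P * ((P * f^`()) * (u * v)) -
    D%:P * (f * (P * u^`() * v - u * (P * v^`()))) = P * (f * v ^+ 2).
  by rewrite -ode; ring.
rewrite ef ev !XsubC_deriv -/P in odeP.
have : A%:P * ((k%:R%:P * f1 + P * f1^`()) * (u * v1)) -
    D%:P * (f1 * (P * u^`() * v1 - u * (m%:R%:P * v1 + P * v1^`())))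
    = P * (f1 * v1 ^+ 2 * P ^+ m).
  apply: (@mulfI _ (P ^+ k * P ^+ m)); first by rewrite mulf_neq0 ?expf_neq0.
  transitivity (P * (P ^+ k * f1 * (P ^+ m * v1) ^+ 2)); last by ring.
  by rewrite -odeP; ring.
move/(congr1 (horner^~ a)).
rewrite /= !(hornerD, hornerN, hornerM, hornerC). rewrite hornerX subrr => e.
apply: (@mulfI _ (f1.[a] * v1.[a])); first by rewrite mulf_neq0.
by rewrite mulr0 -[RHS](mul0r ((f1 * v1 ^+ 2 * P ^+ m).[a])) !hornerM -e; ring.
Qed.

(** The two hypotheses on q and r say that phi = f q / r solves
A f' phi - D f phi' = f. Write phi = u / v in lowest terms. At a root of v, of
multiplicity m > 0, [ode_local] gives A k + D m = 0 with k >= 0, which is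
impossible. *)
Lemma phi_polynomial (A D E E' : K) f q r : f != 0 -> r != 0 ->
  0 < A -> 0 < D -> E' = E + D - A ->
  E%:P * (f^`() * q) - D%:P * (f * q^`()) = r ->
  E'%:P * (f^`() * r) = D%:P * (f * r^`()) ->
  exists phi, A%:P * (f^`() * phi) - D%:P * (f * phi^`()) = f.
Proof.
move=> f0 r0 A0 D0 eE h1 h2.
pose g := gcdp (f * q) r; pose u := (f * q) %/ g; pose v := r %/ g.
have g0 : g != 0 by rewrite gcdp_eq0 negb_and r0 orbT.
have eu : f * q = u * g by rewrite divpK ?dvdp_gcdl.
have ev : r = v * g by rewrite divpK ?dvdp_gcdr.
have v0 : v != 0 by apply: contraNneq r0 => v0; rewrite ev v0 mul0r.
have uv : coprimep u v by apply: coprimep_div_gcd; rewrite r0 orbT.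
have ode : A%:P * (f^`() * (u * v)) - D%:P * (f * (u^`() * v - u * v^`())) =
    f * v ^+ 2.
  have : A%:P * (f^`() * ((f * q) * r)) -
      D%:P * (f * ((f * q)^`() * r - (f * q) * r^`())) = f * r ^+ 2.
    transitivity (f * (A%:P * (f^`() * q * r) -
      D%:P * (f^`() * q * r + f * q^`() * r) + q * (D%:P * (f * r^`())))).
      by rewrite derivM; ring.
    rewrite -h2 eE !(rmorphB, rmorphD) /=.
    by transitivity (f * (r * (E%:P * (f^`() * q) - D%:P * (f * q^`()))));
      [ring | rewrite h1 expr2].
  rewrite eu ev => e; apply: (@mulfI _ (g ^+ 2)); first by rewrite expf_neq0.
  transitivity (f * (v * g) ^+ 2); last by ring.
  by rewrite -e !derivM; ring.
have /size_poly1P [c c0 vc] : size v == 1%N.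
  apply/negPn/negP => /closed_rootP [a va].
  have ua : u.[a] != 0 by apply: (coprimep_root _ va); rewrite coprimep_sym.
  have [k [m [e [_ hm]]]] := ode_local a f0 v0 ode.
  have m0 : (0 < m)%N.
    by rewrite lt0n; apply/eqP => /hm; rewrite (rootP va) eqxx.
  move/eqP: e; rewrite -mulrDl mulf_eq0 (negPf ua) orbF.
  by rewrite gt_eqF // ltr_wpDl ?mulr_gt0 ?mulr_ge0 ?ltr0n // ltW.
exists (c^-1%:P * u).
move: ode; rewrite vc derivC derivM derivC => ode.
apply: (@mulfI _ (c%:P ^+ 2)); first by rewrite expf_neq0 ?polyC_eq0.
transitivity (f * c%:P ^+ 2); last by ring.
have cc : c%:P * c^-1%:P = 1 :> {poly K} by rewrite -rmorphM /= divff.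
rewrite -ode.
transitivity ((c%:P * c^-1%:P) * (c%:P *
  (A%:P * (f^`() * u) - D%:P * (f * u^`())))); first by ring.
by rewrite cc; ring.
Qed.

(** The local exponent of [ode_local] with v = 1 at a root of f, of multiplicity
k > 0: the value u(a) is multiplied by A k + D m > 0 and gives 0. *)
Lemma ode_root (A D : K) f phi a : f != 0 -> 0 < A -> 0 < D ->
  A%:P * (f^`() * phi) - D%:P * (f * phi^`()) = f ->
  root f a -> root phi a.
Proof.
move=> f0 A0 D0 ode fa.
have [|k [m [e [hk hm]]]] := @ode_local A D f phi 1 a f0 (oner_neq0 _).
  by rewrite derivC mulr0 subr0 expr1n !mulr1.
have k0 : (0 < k)%N.
  by rewrite lt0n; apply/eqP => /hk; rewrite (rootP fa) eqxx.
move/eqP: e; rewrite -mulrDl mulf_eq0 gt_eqF //=.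
by rewrite ltr_pwDl ?mulr_gt0 ?mulr_ge0 ?ltr0n ?ler0n // ltW.
Qed.

Lemma only_root p a : p != 0 -> (forall b, root p b -> b = a) ->
  p = (lead_coef p)%:P * ('X - a%:P) ^+ (size p).-1.
Proof.
move=> p0 pa; have [m [g [ep ga]]] := root_factor a p0.
have /size_poly1P [c c0 gc] : size g == 1%N.
  apply/negPn/negP => /closed_rootP [b gb].
  have ba : b = a by apply: pa; rewrite ep rootM gb orbT.
  by move: ga; rewrite -ba (rootP gb) eqxx.
rewrite ep gc lead_coefM lead_coefC lead_coef_exp lead_coefXsubC expr1n mul1r.
rewrite mulrC size_Cmul // size_exp_XsubC /=; by [].
Qed.

(** If k = deg phi is at least 2, the top coefficients give A deg f = D k, which
the inequality excludes; if k = 0, they would give f of smaller degree than f.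
So phi has a single root, and all roots of f are roots of phi. The second
conclusion is read off from the top coefficients for k = 1. *)
Lemma ode_solution (A D : K) f phi : f != 0 -> 0 < A -> 0 < D ->
  A%:P * (f^`() * phi) - D%:P * (f * phi^`()) = f ->
  A * (size f).-1%:R < 2%:R * D ->
  (exists a, f = (lead_coef f)%:P * ('X - a%:P) ^+ (size f).-1) /\
  A * (size f).-1%:R != D.
Proof.
move=> f0 A0 D0 ode lt.
have phi0 : phi != 0.
  by apply: contra_neq f0 => phi0; rewrite -ode phi0 deriv0 !mulr0 subr0.
set n := (size f).-1 in lt *; set k := (size phi).-1.
have sf : size f = n.+1 by rewrite prednK // size_poly_gt0.
have sphi : size phi = k.+1 by rewrite prednK // size_poly_gt0.
have top : (A * n%:R - D * k%:R) * (lead_coef f * lead_coef phi) =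
    ('X * f)`_(n + k).
  rewrite -[in RHS]ode mulrBr; transitivity
    ((A%:P * (('X * f^`()) * phi) - D%:P * (f * ('X * phi^`())))`_(n + k)).
    have e1 : (('X * f^`()) * phi)`_(n + k) = ('X * f^`())`_n * phi`_k.
      by rewrite coef_mul_top ?sphi // -sf size_Xderiv.
    have e2 : (f * ('X * phi^`()))`_(n + k) = f`_n * ('X * phi^`())`_k.
      by rewrite coef_mul_top ?sf // -sphi size_Xderiv.
    rewrite coefB !coefCM e1 e2 !coefXderiv.
    rewrite -[f`_n *+ n]mulr_natr -[phi`_k *+ k]mulr_natr.
    by rewrite !lead_coefE -/n -/k; ring.
  by congr (fun s : {poly K} => s`_(n + k)); ring.
have l0 : lead_coef f * lead_coef phi != 0 by rewrite mulf_neq0 ?lead_coef_eq0.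
have k1 : k = 1%N.
  have [k0|[//|k2]] : k = 0%N \/ k = 1%N \/ (2 <= k)%N by lia.
    have /size_poly1P [c c0 ec] : size phi == 1%N by rewrite sphi k0.
    move: ode; rewrite ec derivC !mulr0 subr0 => ode.
    have := lt_size_deriv f0; rewrite -{2}ode mulrCA -rmorphM mulrC /=.
    by rewrite mul_polyC ltnNge size_scale_leq.
  move: top; rewrite coefXM; case: eqP => [|_]; first by lia.
  rewrite nth_default; last by rewrite sf; lia.
  move/eqP; rewrite mulf_eq0 (negPf l0) orbF subr_eq0 => /eqP e.
  move: lt; rewrite e mulrC ltr_pM2r // ltr_nat; by lia.
split; last first.
  apply/eqP => e; move/eqP: top.
  rewrite k1 mulr1 e subrr mul0r eq_sym coefXM addn1 /= -[n]/(size f).-1.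
  by rewrite -lead_coefE lead_coef_eq0 (negPf f0).
have [a phia] : exists a, root phi a by apply/closed_rootP; rewrite sphi k1.
exists a; apply: only_root => // b fb.
have phib := ode_root f0 A0 D0 ode fb.
have ev c : phi.[c] = phi`_0 + phi`_1 * c.
  by rewrite horner_coef sphi k1 !big_ord_recr big_ord0 /= add0r expr0 expr1 mulr1.
have : phi`_1 * (b - a) = 0.
  have := rootP phib; have := rootP phia; rewrite !ev => ea eb.
  transitivity ((phi`_0 + phi`_1 * b) - (phi`_0 + phi`_1 * a)); first by ring.
  by rewrite ea eb subrr.
move/eqP; rewrite mulf_eq0 subr_eq0 => /orP [/eqP z|/eqP //].
by have := lead_coef_eq0 phi; rewrite lead_coefE sphi k1 /= z eqxx (negPf phi0).
Qed.

(** At a root b <> a of multiplicity m, the right-hand side vanishes to order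
m - 1 only. *)
Lemma power_of_linear (e1 e2 : K) g a : g != 0 -> e2 != 0 ->
  e1%:P * g = e2%:P * (('X - a%:P) * g^`()) ->
  g = (lead_coef g)%:P * ('X - a%:P) ^+ (size g).-1.
Proof.
move=> g0 e20 e; apply: only_root => // b gb.
apply/eqP; rewrite -subr_eq0; apply/negPn/negP => ba.
have [m [h [eg hb]]] := root_factor b g0.
have m0 : (0 < m)%N.
  rewrite lt0n; apply: contraNneq hb => m0.
  by move: gb; rewrite eg m0 expr0 mul1r.
have : e1%:P * (('X - b%:P) * h) =
    e2%:P * (('X - a%:P) * (m%:R%:P * h + ('X - b%:P) * h^`())).
  apply: (@mulfI _ (('X - b%:P) ^+ m)); first by rewrite expf_neq0 ?polyXsubC_eq0.
  transitivity (('X - b%:P) * (e1%:P * g)); first by rewrite eg; ring.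
  rewrite e; transitivity (e2%:P * (('X - a%:P) * (('X - b%:P) * g^`()))); first by ring.
  by rewrite eg XsubC_deriv; ring.
move/(congr1 (fun s : {poly K} => s.[b])).
rewrite !(hornerD, hornerN, hornerM, hornerC, hornerX) => eqb.
have : e2 * ((b - a) * (m%:R * h.[b])) = 0.
  transitivity (e2 * ((b - a) * (m%:R * h.[b] + (b - b) * h^`().[b])) -
    e1 * ((b - b) * h.[b])); first by ring.
  by rewrite eqb subrr.
move/eqP; rewrite !mulf_eq0.
rewrite (negPf e20) (negPf ba) (negPf hb) pnatr_eq0 orbF /=.
by rewrite -leqn0 leqNgt m0.
Qed.

End Univariate.

(** * Weights and leading forms *)

Definition wt (w : int * int) (k : 'X_{1..2}) : int :=
  w.1 * (k 0)%:Z + w.2 * (k 1)%:Z.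

Definition mn (i j : nat) : 'X_{1..2} := [multinom [tuple i; j]].

Lemma mnE0 i j : mn i j 0 = i.
Proof. by rewrite /mn /fun_of_multinom /= (tnth_nth 0%N). Qed.

Lemma mnE1 i j : mn i j 1 = j.
Proof. by rewrite /mn /fun_of_multinom /= (tnth_nth 0%N). Qed.

Lemma mnm2P (k l : 'X_{1..2}) : k 0 = l 0 -> k 1 = l 1 -> k = l.
Proof.
move=> e0 e1; apply/mnmP => i.
have [->|->] : i = 0 \/ i = 1.
  by case: i => -[|[|//]] h; [left|right]; apply: val_inj.
all: by [].
Qed.

Lemma mn_eta (k : 'X_{1..2}) : mn (k 0) (k 1) = k.
Proof. by apply: mnm2P; rewrite ?mnE0 ?mnE1. Qed.

Lemma wtD w (k l : 'X_{1..2}) : wt w (k + l)%MM = wt w k + wt w l.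
Proof. by rewrite /wt !mnmDE !PoszD; ring. Qed.

Lemma wt0 w : wt w 0%MM = 0.
Proof. by rewrite /wt !mnm0E; ring. Qed.

Lemma wt_mn w i j : wt w (mn i j) = w.1 * i%:Z + w.2 * j%:Z.
Proof. by rewrite /wt mnE0 mnE1. Qed.

Lemma wt_inj w (k l : 'X_{1..2}) :
  w.2 != 0 -> wt w k = wt w l -> k 0 = l 0 -> k = l.
Proof.
move=> w0 e e0; apply: mnm2P => //; move: e; rewrite /wt e0 => /addrI.
by move/(mulfI w0) => -[].
Qed.

Lemma mdeg2 (k : 'X_{1..2}) : mdeg k = (k 0%R + k 1%R)%N.
Proof.
rewrite mdegE !big_ord_recr big_ord0 /= add0n.
by congr (k _ + k _)%N; apply: val_inj.
Qed.

Section Lead.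
Variable K : numClosedFieldType.
Local Notation poly2 := {mpoly K[2]}.
Implicit Types (F G : poly2) (w : int * int) (D E : int).

Definition degle w D F : Prop := {in msupp F, forall k, wt w k <= D}.

(** The part of weight D of F, evaluated at y = 1. If w.2 <> 0, no information is
lost: the weight and the exponent of x determine the exponent of y. Weights are
integers because the weight (-1, 1) is needed. *)
Definition lead w D F : {poly K} :=
  \sum_(k <- msupp F | wt w k == D) F@_k *: 'X^(k 0).

Lemma lead_widen w D F (r : seq 'X_{1..2}) : uniq r ->
  {subset msupp F <= r} ->
  lead w D F = \sum_(k <- r | wt w k == D) F@_k *: 'X^(k 0).
Proof.
move=> ur sub; have p : perm_eq (msupp F) [seq k <- r | k \in msupp F].
  apply: uniq_perm; rewrite ?msupp_uniq ?filter_uniq // => k.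
  by rewrite mem_filter; case: (boolP (k \in msupp F)) => // /sub ->.
rewrite /lead (perm_big _ p) big_filter_cond.
rewrite [RHS](bigID (fun k => k \in msupp F)) /= [X in _ = _ + X]big1 ?addr0.
  by apply: eq_bigl => k; rewrite andbC.
by move=> k /andP [_ /memN_msupp_eq0 ->]; rewrite scale0r.
Qed.

Lemma lead_is_linear w D : linear (lead w D).
Proof.
move=> c F G; pose r := undup (msupp F ++ msupp G ++ msupp (c *: F + G)).
have sub (H : poly2) : {subset msupp H <= msupp F ++ msupp G ++
    msupp (c *: F + G)} -> {subset msupp H <= r}.
  by move=> h k /h; rewrite mem_undup.
rewrite !(@lead_widen w D _ r) ?undup_uniq //; try apply: sub.
- rewrite scaler_sumr -big_split /=; apply: eq_bigr => k _.
  by rewrite mcoeffD mcoeffZ scalerDl scalerA.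
- by move=> k kG; rewrite !mem_cat kG orbT.
- by move=> k kF; rewrite !mem_cat kF.
by move=> k kH; rewrite !mem_cat kH !orbT.
Qed.

HB.instance Definition _ w D :=
  GRing.isLinear.Build K poly2 {poly K} _ (lead w D) (lead_is_linear w D).

Lemma leadX w D m : lead w D 'X_[m] = if wt w m == D then 'X^(m 0) else 0.
Proof. by rewrite /lead msuppX big_mkcond big_seq1 mcoeffX eqxx scale1r. Qed.

Lemma coef_lead w D F k : w.2 != 0 -> wt w k = D -> (lead w D F)`_(k 0) = F@_k.
Proof.
move=> w0 e; rewrite /lead coef_sum.
have [kF|kF] := boolP (k \in msupp F).
  rewrite big_mkcond (bigD1_seq k) ?msupp_uniq //= e eqxx coefZ coefXn eqxx mulr1.
  rewrite big1 ?addr0 // => l lk; case: eqP => // el.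
  rewrite coefZ coefXn; case: eqP => [e0|]; last by rewrite mulr0.
  by case/eqP: lk; apply: (@wt_inj w) => //; rewrite el e.
rewrite memN_msupp_eq0 // big1_seq // => l /andP [/eqP el lF].
rewrite coefZ coefXn; case: eqP => [e0|]; last by rewrite mulr0.
suff lk : l = k by move: kF; rewrite -lk lF.
by apply: (@wt_inj w) => //; rewrite el e.
Qed.

Lemma coef_lead_mn w D F i j : w.2 != 0 -> wt w (mn i j) = D ->
  (lead w D F)`_i = F@_(mn i j).
Proof. by move=> w0 e; rewrite -(coef_lead F w0 e) mnE0. Qed.

Lemma coef_lead_neq0 w D F i : (lead w D F)`_i != 0 ->
  exists j, wt w (mn i j) = D.
Proof.
rewrite /lead coef_sum => ne.
pose on (k : 'X_{1..2}) := [&& k \in msupp F, wt w k == D & k 0 == i].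
have [k /and3P [kF /eqP e h]|none] :=
    pickP [pred k : 'X_{1..2 < msize F} | on k].
  by exists ((k : 'X_{1..2}) 1); rewrite -(eqP h) mn_eta.
case/eqP: ne; rewrite big1_seq // => k /andP [/eqP e kF].
rewrite coefZ coefXn; case: eqP => [ei|]; last by rewrite mulr0.
have := none (BMultinom (msize_mdeg_lt kF)).
by rewrite /= /on /= kF e eqxx ei eqxx.
Qed.

Lemma degle0 w D : degle w D 0.
Proof. by move=> k; rewrite msupp0. Qed.

Lemma degleD w D F G : degle w D F -> degle w D G -> degle w D (F + G).
Proof.
by move=> dF dG k /msuppD_le; rewrite mem_cat => /orP [/dF|/dG].
Qed.

Lemma degleZ w D c F : degle w D F -> degle w D (c *: F).
Proof. by move=> dF k /msuppZ_le /dF. Qed.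

Lemma degleN w D F : degle w D F -> degle w D (- F).
Proof. by rewrite -scaleN1r; exact: degleZ. Qed.

Lemma degle_sum w D (I : Type) (r : seq I) (P : pred I) (F : I -> poly2) :
  (forall i, P i -> degle w D (F i)) -> degle w D (\sum_(i <- r | P i) F i).
Proof.
by move=> dF; elim/big_ind: _ => //; [exact: degle0 | exact: degleD].
Qed.

Lemma degle_le w D E F : D <= E -> degle w D F -> degle w E F.
Proof. by move=> DE dF k /dF /le_trans; apply. Qed.

Lemma degleM w D E F G : degle w D F -> degle w E G -> degle w (D + E) (F * G).
Proof.
move=> dF dG k /msuppM_le /allpairsP [[a b] /= [aF bG ->]].
by rewrite wtD lerD ?dF ?dG.
Qed.

Lemma degleX w m : degle w (wt w m) 'X_[m].
Proof. by move=> k; rewrite msuppX inE => /eqP ->. Qed.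

Lemma degleC w c : degle w 0 c%:MP_[2].
Proof.
move=> k; rewrite msuppC; case: eqP => // _.
by rewrite inE => /eqP ->; rewrite wt0.
Qed.

Lemma degleXn w E F n : degle w E F -> degle w (E * n%:Z) (F ^+ n).
Proof.
move=> dF; elim: n => [|n IH]; first by rewrite mulr0 expr0 -mpolyC1; exact: degleC.
by rewrite exprS (_ : E * n.+1%:Z = E + E * n%:Z); [exact: degleM|lia].
Qed.

Lemma lead_gt w D E F : degle w D F -> D < E -> lead w E F = 0.
Proof.
move=> dF DE; rewrite /lead big1_seq // => k /andP [/eqP e /dF].
by rewrite e leNgt DE.
Qed.

Lemma lead_neq0_degle w D E F : degle w D F -> lead w E F != 0 -> E <= D.
Proof.
by move=> dF; apply: contraNT; rewrite -ltNge => /(lead_gt dF) ->.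
Qed.

Lemma mpoly_linear_ind (P : poly2 -> Prop) :
  (forall k, P 'X_[k]) -> (forall c F G, P F -> P G -> P (c *: F + G)) ->
  forall F, P F.
Proof.
move=> PX PD F; rewrite (mpolyE F).
elim: (msupp F) => [|k r IH]; last by rewrite big_cons; apply: PD.
by rewrite big_nil -[0](addNr 'X_[0%MM]) -scaleN1r; exact: PD.
Qed.

Lemma leadP w D c F G : lead w D (c *: F + G) = c *: lead w D F + lead w D G.
Proof. exact: lead_is_linear. Qed.

Lemma leadM w D E F G : degle w D F -> degle w E G ->
  lead w (D + E) (F * G) = lead w D F * lead w E G.
Proof.
move=> dF dG; have el (H : poly2) A : lead w A H =
    \sum_(k <- msupp H) H@_k *: (if wt w k == A then 'X^(k 0) else 0).
  by rewrite /lead big_mkcond; apply: eq_bigr => k _; case: ifP; rewrite ?scaler0.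
rewrite (el F D) (el G E) {1}(mpolyE F) {1}(mpolyE G) !big_distrlr /= linear_sum /=.
apply: eq_big_seq => k kF; rewrite linear_sum /=; apply: eq_big_seq => l lG.
rewrite -scalerAl -scalerAr linearZ linearZ /= -mpolyXD leadX wtD mnmDE.
rewrite -[RHS]scalerAl -[X in _ = _ *: X]scalerAr.
congr (_ *: (_ *: _)); have := dF k kF; have := dG l lG.
case: (eqVneq (wt w k) D) => [->|nk]; case: (eqVneq (wt w l) E) => [->|nl] lk ll.
- by rewrite eqxx exprD.
- by rewrite mulr0; case: eqP => // e; exfalso; move/eqP: nl; lia.
- by rewrite mul0r; case: eqP => // e; exfalso; move/eqP: nk; lia.
by rewrite mulr0; case: eqP => // e; exfalso; move/eqP: nk; lia.
Qed.

Lemma lead_exists w F : F != 0 -> w.2 != 0 ->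
  exists2 D, degle w D F & lead w D F != 0.
Proof.
move=> F0 w0.
have [k kF kmax] : exists2 k, k \in msupp F & degle w (wt w k) F.
  have : msupp F != [::] by rewrite msupp_eq0.
  rewrite /degle; elim: (msupp F) => [//|k r IH] _.
  have [->|/IH [l lr lmax]] := eqVneq r [::].
    by exists k; rewrite ?mem_head // => l; rewrite inE => /eqP ->.
  have [le|lt] := leP (wt w l) (wt w k).
    exists k; rewrite ?mem_head // => m; rewrite inE => /orP [/eqP -> //|/lmax h].
    exact: le_trans h le.
  exists l; rewrite ?inE ?lr ?orbT // => m; rewrite inE => /orP [/eqP ->|/lmax //].
  exact: ltW.
exists (wt w k) => //; apply/eqP => e.
have := coef_lead F w0 (erefl (wt w k)); rewrite e coef0 => /esym/eqP.
by rewrite mcoeff_eq0 kF.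
Qed.

Lemma degle_lead0 w D F : w.2 != 0 -> degle w D F -> lead w D F = 0 ->
  degle w (D - 1) F.
Proof.
move=> w0 dF l0 k kF; have := dF k kF.
rewrite le_eqVlt => /orP [/eqP e|]; last by lia.
have := coef_lead F w0 e; rewrite l0 coef0 => /esym/eqP.
by rewrite mcoeff_eq0 kF.
Qed.

Lemma degle_dx w D F : degle w D F -> degle w (D - w.1) F^`M(0).
Proof.
move=> dF k; rewrite mcoeff_msupp mcoeff_deriv mulrn_eq0 /= -mcoeff_msupp => /dF.
by rewrite wtD /wt !mnm1E /=; lia.
Qed.

Lemma degle_dy w D F : degle w D F -> degle w (D - w.2) F^`M(1).
Proof.
move=> dF k; rewrite mcoeff_msupp mcoeff_deriv mulrn_eq0 /= -mcoeff_msupp => /dF.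
by rewrite wtD /wt !mnm1E /=; lia.
Qed.

Lemma lead_dx w D F : lead w (D - w.1) F^`M(0) = (lead w D F)^`().
Proof.
elim/mpoly_linear_ind: F => [k|c F G IF IG]; last first.
  by rewrite mderivD mderivZ !leadP derivD derivZ IF IG.
rewrite mderivX leadX linearZ /= leadX.
case: (posnP (k 0)) => [k0|k0].
  by rewrite k0 scale0r; case: ifP => _; rewrite ?expr0 ?derivC ?deriv0.
have ek : (k = (k - U_(0%R)) + U_(0%R))%MM.
  by rewrite submK //; apply/mnm_lepP => i; rewrite mnm1E; case: eqP => // <-.
have -> : (wt w (k - U_(0%R))%MM == D - w.1) = (wt w k == D).
  rewrite {2}ek wtD /(wt w U_(0%R)%MM) !mnm1E /=; lia.
case: ifP => _; last by rewrite deriv0 scaler0.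
by rewrite derivXn mnmBE mnm1E eqxx subn1 scaler_nat.
Qed.

Lemma XderivXn i : 'X * ('X^i)^`() = i%:R *: 'X^i :> {poly K}.
Proof.
by apply/polyP => j; rewrite coefXderiv coefZ coefXn; case: eqP => [->|_];
  rewrite ?mulr1 ?mul0rn ?mulr0.
Qed.

(** Euler's relation w.1 x F_x + w.2 y F_y = D F for forms of weight D. *)
Lemma lead_dy w D F : w.2%:~R *: lead w (D - w.2) F^`M(1) =
  D%:~R *: lead w D F - w.1%:~R *: ('X * (lead w D F)^`()) :> {poly K}.
Proof.
elim/mpoly_linear_ind: F => [k|c F G IF IG]; last first.
  rewrite mderivD mderivZ !leadP derivD derivZ scalerDr.
  rewrite ![_%:~R *: (c *: _)]scalerA [_%:~R * c]mulrC -!scalerA IF IG.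
  by rewrite -!mul_polyC; ring.
rewrite mderivX leadX linearZ /= leadX.
case: (posnP (k 1)) => [k1|k1].
  rewrite k1 scale0r scaler0; case: eqP => [e|_]; last first.
    by rewrite deriv0 !(scaler0, mulr0) subr0.
  rewrite XderivXn -e /wt k1 mulr0 addr0 rmorphM /= -scalerA.
  by rewrite -[X in _ *: (X *: _)]/((k 0)%:R) subrr.
have ek : (k = (k - U_(1%R)) + U_(1%R))%MM.
  by rewrite submK //; apply/mnm_lepP => i; rewrite mnm1E; case: eqP => // <-.
have -> : (wt w (k - U_(1%R))%MM == D - w.2) = (wt w k == D).
  rewrite {2}ek wtD /(wt w U_(1%R)%MM) !mnm1E /=; lia.
case: eqP => [e|_]; last by rewrite deriv0 !(scaler0, mulr0) subr0.
rewrite mnmBE mnm1E /= subn0 XderivXn -e /wt rmorphD !rmorphM /=.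
rewrite -[(k 0)%:~R]/((k 0)%:R) -[(k 1)%:~R]/((k 1)%:R) -!mul_polyC.
by rewrite !(rmorphD, rmorphM) /=; ring.
Qed.

(** For K = R[i] this is [jac] by definition. *)
Definition bracket F G : poly2 := F^`M(0) * G^`M(1) - G^`M(0) * F^`M(1).

(** By [lead_dy], y F_y is a combination of F and x F_x at y = 1; the products of
two x-derivatives cancel. *)
Lemma lead_bracket w D E F G : degle w D F -> degle w E G ->
  degle w (D + E - (w.1 + w.2)) (bracket F G) /\
  w.2%:~R *: lead w (D + E - (w.1 + w.2)) (bracket F G) =
    E%:~R *: ((lead w D F)^`() * lead w E G) -
    D%:~R *: (lead w D F * (lead w E G)^`()).
Proof.
move=> dF dG.
have e1 : D + E - (w.1 + w.2) = (D - w.1) + (E - w.2) by ring.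
have e2 : D + E - (w.1 + w.2) = (E - w.1) + (D - w.2) by ring.
have d1 : degle w (D + E - (w.1 + w.2)) (F^`M(0) * G^`M(1)).
  by rewrite e1; apply: degleM; [exact: degle_dx|exact: degle_dy].
have d2 : degle w (D + E - (w.1 + w.2)) (G^`M(0) * F^`M(1)).
  by rewrite e2; apply: degleM; [exact: degle_dx|exact: degle_dy].
split; first by apply: degleD => //; apply: degleN.
rewrite /bracket linearB /= {1}e1 e2.
rewrite !leadM; try exact: degle_dx; try exact: degle_dy.
rewrite !lead_dx scalerBr !scalerAr !lead_dy -!mul_polyC; ring.
Qed.
End Lead.

(** * The bracket and the leading forms of K[F, G] *)

Section Bracket.
Variable K : numClosedFieldType.
Local Notation poly2 := {mpoly K[2]}.
Implicit Types (F G P Q : poly2).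

Lemma bracketC F c : bracket F c%:MP = 0.
Proof. by rewrite /bracket !mderivC mulr0 mul0r subrr. Qed.

Lemma bracketDr F P Q : bracket F (P + Q) = bracket F P + bracket F Q.
Proof. by rewrite /bracket !mderivD; ring. Qed.

Lemma bracketMr F P Q : bracket F (P * Q) = bracket F P * Q + P * bracket F Q.
Proof. by rewrite /bracket !mderivM; ring. Qed.

Lemma bracket_sym F P : bracket P F = - bracket F P.
Proof. by rewrite /bracket; ring. Qed.

Lemma bracket_self F : bracket F F = 0.
Proof. by rewrite /bracket; ring. Qed.

Lemma bracketZr F a P : bracket F (a *: P) = a *: bracket F P.
Proof. by rewrite -!mul_mpolyC bracketMr bracketC mul0r add0r. Qed.

Lemma bracketZl F a P : bracket (a *: F) P = a *: bracket F P.
Proof. by rewrite bracket_sym bracketZr (bracket_sym P F) scalerN. Qed.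

End Bracket.

Section Subalgebra.
Variable K : numClosedFieldType.
Local Notation poly2 := {mpoly K[2]}.
Variables (F G : poly2) (c : K).
Hypothesis jacFG : bracket F G = c%:MP.
Hypothesis c0 : c != 0.

(** The inner variable goes to F and the outer one to G, so that [F, -] acts on
K[F, G] as the derivative in the outer variable. *)
Definition ev (P : {poly {poly K}}) : poly2 := (map_poly (horner_alg F) P).[G].

Lemma ev_is_linear (a : K) P Q : ev ((a%:P)%:P * P + Q) = a *: ev P + ev Q.
Proof.
rewrite /ev rmorphD rmorphM /= hornerD hornerM map_polyC /= hornerC.
by rewrite horner_algC mulr_algl.
Qed.

Lemma ev0 : ev 0 = 0. Proof. by rewrite /ev rmorph0 horner0. Qed.
Lemma evD P Q : ev (P + Q) = ev P + ev Q.
Proof. by rewrite /ev rmorphD hornerD. Qed.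
Lemma evM P Q : ev (P * Q) = ev P * ev Q.
Proof. by rewrite /ev rmorphM hornerM. Qed.
Lemma evX : ev 'X = G. Proof. by rewrite /ev map_polyX hornerX. Qed.
Lemma evC p : ev p%:P = horner_alg F p.
Proof. by rewrite /ev map_polyC hornerC. Qed.

Lemma bracket_horner_algl p Q :
  bracket (horner_alg F p) Q = horner_alg F p^`() * bracket F Q.
Proof.
elim/poly_ind: p => [|p a IH].
  by rewrite deriv0 !rmorph0 mul0r -[0]mpolyC0 bracket_sym bracketC oppr0.
rewrite derivMXaddC !rmorphD !rmorphM /= horner_algX horner_algC alg_mpolyC.
rewrite bracket_sym bracketDr bracketC addr0 bracketMr.
rewrite (bracket_sym F Q) (bracket_sym (horner_alg F p) Q) IH.
by ring.
Qed.

Lemma bracket_ev P : bracket F (ev P) = c *: ev P^`().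
Proof.
elim/poly_ind: P => [|P p IH]; first by rewrite deriv0 ev0 -[0]mpolyC0 bracketC scaler0.
rewrite derivMXaddC !evD !evM evX evC bracketDr bracketMr IH jacFG.
rewrite [bracket F (horner_alg F p)]bracket_sym bracket_horner_algl bracket_self.
rewrite mulr0 oppr0 addr0.
by rewrite -!mul_mpolyC; ring.
Qed.

Lemma horner_alg_inj p : horner_alg F p = 0 -> p = 0.
Proof.
move: {2}(size p) (leqnn (size p)) => n; elim: n p => [|n IH] p.
  by rewrite leqn0 size_poly_eq0 => /eqP.
move=> sp e; have [//|p0] := eqVneq p 0.
have p'0 : p^`() = 0.
  apply: IH; first by have := lt_size_deriv p0; lia.
  apply: (@mulIf _ c%:MP_[2]); first by rewrite mpolyC_eq0.
  rewrite mul0r -jacFG -bracket_horner_algl e bracket_sym -[0]mpolyC0 bracketC.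
  by rewrite mpolyC0 oppr0.
move: e; rewrite (deriv_eq0 p'0) horner_algC alg_mpolyC => /eqP.
by rewrite mpolyC_eq0 => /eqP ->.
Qed.

(** F and G are algebraically independent: the bracket with F differentiates a
relation between them in G, and the bracket with G differentiates a relation on
F alone, so that a nontrivial relation of least degree cannot exist. *)
Lemma ev_inj P : ev P = 0 -> P = 0.
Proof.
move: {2}(size P) (leqnn (size P)) => n; elim: n P => [|n IH] P.
  by rewrite leqn0 size_poly_eq0 => /eqP.
move=> sP e; have [//|P0] := eqVneq P 0.
have P'0 : P^`() = 0.
  apply: IH; first by have := lt_size_deriv P0; lia.
  apply: (@scalerI _ _ c) => //.
  by rewrite -bracket_ev e -[0]mpolyC0 bracketC mpolyC0 scaler0.
have eP : P = (P`_0)%:P.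
  apply/polyP => -[|i]; rewrite coefC //=.
  have /eqP := congr1 (fun s : {poly {poly K}} => s`_i) P'0.
  rewrite coef_deriv coef0 -mulr_natr mulf_eq0 -[_%:R](rmorph_nat (@polyC K)).
  by rewrite polyC_eq0 pnatr_eq0 orbF => /eqP.
by move: e; rewrite eP evC => /horner_alg_inj ->.
Qed.

Variables (w : int * int) (D : int).
Hypothesis w2 : 0 < w.2.
Hypothesis w12 : 0 < w.1 + w.2.
Hypothesis D0 : 0 < D.
Hypothesis degF : degle w D F.
Local Notation f := (lead w D F).
Hypothesis f0 : f != 0.

(** The leading forms of F and Q have bracket 0, as expressed by
[lead_bracket]. *)
Definition commutes (Q : poly2) : Prop := forall E, degle w E Q ->
  lead w E Q != 0 ->
  E%:~R%:P * (f^`() * lead w E Q) = D%:~R%:P * (f * (lead w E Q)^`()).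

(** Comparing degrees, E deg f = D deg q. If E < 0 this makes q constant, so that
Q has a leading monomial y^j, of weight w.2 j >= 0. *)
Lemma commutes_deg_ge0 Q E : commutes Q -> degle w E Q -> lead w E Q != 0 -> 0 <= E.
Proof.
move=> com dQ q0; have := top_relation f0 q0 (com E dQ q0).
rewrite -[X in _ * X = _]/((_%:Z)%:~R) -[X in _ = _ * X]/((_%:Z)%:~R) -!rmorphM /=.
move=> /eqP; rewrite eqr_int => /eqP e; rewrite leNgt; apply/negP => E0.
have sq : (size (lead w E Q)).-1 = 0%N.
  have [//|sq] := posnP (size (lead w E Q)).-1.
  have : 0 < D * (size (lead w E Q)).-1%:Z by rewrite mulr_gt0 // ltz_nat.
  by rewrite -e ltNge mulr_le0_ge0 // ltW.
have : (lead w E Q)`_0 != 0.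
  by have := lead_coef_eq0 (lead w E Q); rewrite lead_coefE sq (negPf q0) => ->.
move/coef_lead_neq0 => [j]; rewrite wt_mn mulr0 add0r => ej.
by move: E0; rewrite -ej ltNge mulr_ge0 // ltW.
Qed.

(** A dimension count: two forms of the same weight that commute with f are
proportional by [wronskian_prop]. So one element can be used to lower the weight
of all the others, and the number of elements still exceeds the number of
possible weights, which are nonnegative by [commutes_deg_ge0]. *)
Lemma linear_relation n (P : 'I_n.+1 -> {poly {poly K}}) :
  (forall Q, commutes (ev Q)) ->
  (forall i, degle w (n%:Z - 1) (ev (P i))) ->
  exists2 a : 'I_n.+1 -> K, exists i, a i != 0 &
    ev (\sum_i (a i)%:P%:P * P i) = 0.
Proof.
have w20 : w.2 != 0 by rewrite gt_eqF.
move=> all_com; elim: n P => [|n IH] P degP.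
  exists (fun=> 1); first by exists 0; rewrite oner_neq0.
  rewrite big_ord1 !mul1r; apply/eqP/negPn/negP => e0.
  have [E dE lE] := lead_exists e0 w20.
  have := commutes_deg_ge0 (@all_com _) dE lE.
  by have := lead_neq0_degle (degP _) lE; lia.
have en : n.+1%:Z - 1 = n%:Z by lia.
rewrite en in degP.
have [i0 [b hb]] : exists i0, exists b : 'I_n.+1 -> K, forall j,
    lead w n (ev (P (lift i0 j))) = (b j)%:P * lead w n (ev (P i0)).
  have [[i0 h0]|none] := pselect (exists i0, lead w n (ev (P i0)) != 0).
    exists i0; apply: (@fin_all_exists _ (fun=> K) (fun j b => _ = b%:P * _)) => j.
    have [->|hj] := eqVneq (lead w n (ev (P (lift i0 j)))) 0.
      by exists 0; rewrite mul0r.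
    apply: wronskian_prop => //.
    have e0 := @all_com _ _ (degP i0) h0; have ej := @all_com _ _ (degP _) hj.
    set p := lead w n (ev (P i0)) in h0 e0 *; set q := lead w n _ in hj ej *.
    apply: (@mulfI _ (D%:~R%:P * f)).
      by rewrite mulf_neq0 // polyC_eq0 intr_eq0 gt_eqF.
    transitivity (D%:~R%:P * (f * p^`()) * q); first by ring.
    by rewrite -e0; transitivity (p * (D%:~R%:P * (f * q^`()))); [rewrite -ej|]; ring.
  exists 0, (fun=> 0) => j; rewrite mul0r; apply/eqP/negPn/negP => h.
  by apply: none; exists (lift 0 j).
have [j|a [j aj] ea] := IH (fun j => (- b j)%:P%:P * P i0 + P (lift i0 j)).
  apply: degle_lead0 => //.
    by rewrite ev_is_linear; apply: degleD; [apply: degleZ|].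
  by rewrite ev_is_linear leadP hb -mul_polyC rmorphN; ring.
exists (fun i => if unlift i0 i is Some j then a j else - \sum_j a j * b j).
  by exists (lift i0 j); rewrite liftK.
rewrite (bigD1_ord i0) //= unlift_none -[RHS]ea; congr ev.
rewrite [X in _ + X](eq_bigr (fun j => (a j)%:P%:P * P (lift i0 j)));
  last by move=> i _; rewrite liftK.
under [RHS]eq_bigr => i _ do rewrite mulrDr mulrA.
rewrite big_split /= -mulr_suml; congr (_ * _ + _).
rewrite -sumrN !rmorph_sum /=; apply: eq_bigr => i _.
by rewrite -mulrN !rmorphM.
Qed.

(** If G has weight at most d, the k^2 products F^i G^j with i, j < k have weight
at most (k - 1) (D + d). For k = D + d + 2 this is less than k^2 - 1, and
[linear_relation] would contradict the independence of F and G. *)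
Lemma exists_noncommuting : exists P, ~ commutes (ev P).
Proof.
apply: contrapT => none.
have all_com P : commutes (ev P).
  by apply: contrapT => h; apply: none; exists P.
have [d [d0 degG]] : exists d : nat, (0 < d)%N /\ degle w d%:Z G.
  have [->|G0] := eqVneq G 0; first by exists 1%N; split => //; exact: degle0.
  have [E dE _] := lead_exists G0 (lt0r_neq0 w2).
  by exists `|E|.+1; split => //; apply: degle_le dE; lia.
have [e eD] : exists e : nat, D = e%:Z by exists `|D|%N; lia.
have dF : degle w e%:Z F by rewrite -eD.
(* the pair (i %/ k, i %% k) enumerates the exponents *)
pose k := (e + d + 2)%N; have kk : (k * k = (k * k).-1.+1)%N by rewrite /k; lia.
pose P (i : 'I_(k * k).-1.+1) : {poly {poly K}} := ('X^(i %/ k))%:P * 'X^(i %% k).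
have [i|a [i0 ai0] ea] := linear_relation (P := P) all_com.
  rewrite /P evM evC rmorphXn /= horner_algX.
  have -> : ev 'X^(i %% k) = G ^+ (i %% k).
    by rewrite /ev rmorphXn /= map_polyX hornerXn.
  apply: degle_le (degleM (degleXn dF) (degleXn degG)).
  have k0 : (0 < k)%N by rewrite /k; lia.
  have i1 : (i %/ k <= k.-1)%N.
    have : (i < k * k)%N by have := ltn_ord i; lia.
    by rewrite -ltn_divLR //; lia.
  have i2 : (i %% k <= k.-1)%N by have := ltn_pmod i k0; lia.
  have : (e * (i %/ k) + d * (i %% k) <= e * k.-1 + d * k.-1)%N.
    by rewrite leq_add ?leq_mul2l ?i1 ?i2 ?orbT.
  rewrite /k in kk *; nia.
move/ev_inj: ea => ea; case/eqP: ai0.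
have := congr1 (fun s : {poly {poly K}} => s`_(i0 %% k)`_(i0 %/ k)) ea.
rewrite coef_sum coef_sum (bigD1 i0) //= big1 => [|i ni].
  rewrite addr0 coefCM coefCM /P coefCM coefXn eqxx mulr1 coefXn eqxx mulr1.
  by rewrite !coef0.
rewrite coefCM coefCM /P coefCM coefXn; case: eqP => [e2|_].
  rewrite mulr1 coefXn; case: eqP => [e1|_]; last by rewrite mulr0.
  case/eqP: ni; apply: val_inj => /=.
  by rewrite (divn_eq i k) (divn_eq i0 k) e1 e2.
by rewrite mulr0 coef0 mulr0.
Qed.

(** Take P of least degree in the outer variable such that the leading form q of
ev P does not commute with f. The form r = E f' q - D f q' is not 0, so that by
[lead_bracket] it is, up to a constant, the leading form of [F, ev P], a
constant times ev P'. By the choice of P, r commutes with f, and f q / r is a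
solution. *)
Lemma leading_eigenvector : exists phi,
  (w.1 + w.2)%:~R%:P * (f^`() * phi) - D%:~R%:P * (f * phi^`()) = f.
Proof.
have [P nP Pmin] : exists2 P, ~ commutes (ev P) &
    forall P' : {poly {poly K}}, (size P' < size P)%N -> commutes (ev P').
  have [P0 nP0] := exists_noncommuting.
  move: {2}(size P0) (leqnn (size P0)) => n; elim: n P0 nP0 => [|n IH] P nP sP.
    by exists P => // P'; lia.
  have [[P' [sP' nP']]|h] := pselect (exists P' : {poly {poly K}},
    (size P' < size P)%N /\ ~ commutes (ev P')).
    by apply: (IH P') => //; lia.
  by exists P => // P' sP'; apply: contrapT => nP'; apply: h; exists P'.
have [E [dE [q0 ne]]] : exists E, degle w E (ev P) /\ lead w E (ev P) != 0 /\
    E%:~R%:P * (f^`() * lead w E (ev P)) <> D%:~R%:P * (f * (lead w E (ev P))^`()).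
  apply: contrapT => h; apply: nP => E dE q0; apply: contrapT => ne.
  by apply: h; exists E.
set q := lead w E (ev P) in q0 ne.
pose r := E%:~R%:P * (f^`() * q) - D%:~R%:P * (f * q^`()).
have r0 : r != 0 by rewrite subr_eq0; apply/eqP.
have P0 : P != 0.
  by apply: contraNneq q0 => P0; rewrite /q P0 ev0 /lead msupp0 big_nil.
have [dJ lJ] := lead_bracket degF dE.
rewrite bracket_ev in dJ lJ.
set E' := D + E - (w.1 + w.2) in dJ lJ.
have dE' : degle w E' (ev P^`()).
  by rewrite -[ev _]scale1r -(mulVf c0) -scalerA; apply: degleZ.
have wc : w.2%:~R * c != 0 by rewrite mulf_neq0 // intr_eq0 gt_eqF.
have rE : (w.2%:~R * c)%:P * lead w E' (ev P^`()) = r.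
  move: lJ; rewrite linearZ /= scalerA -!mul_polyC => ->.
  by rewrite /r.
have com' : E'%:~R%:P * (f^`() * r) = D%:~R%:P * (f * r^`()).
  have q'0 : lead w E' (ev P^`()) != 0.
    by apply: contraNneq r0 => z; rewrite -rE z mulr0.
  have := Pmin _ (lt_size_deriv P0) E' dE' q'0 => e.
  rewrite -rE derivM derivC mul0r add0r.
  transitivity ((w.2%:~R * c)%:P *
    (E'%:~R%:P * (f^`() * lead w E' (ev P^`())))); first by ring.
  by rewrite e; ring.
apply: (phi_polynomial f0 r0 _ _ _ (erefl r) com'); rewrite ?ltr0z //.
by rewrite /E' rmorphB rmorphD /= [_ + E%:~R]addrC.
Qed.

Lemma leading_form_power : (w.1 + w.2) * (size f).-1%:Z < 2 * D ->
  (exists a, f = (lead_coef f)%:P * ('X - a%:P) ^+ (size f).-1) /\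
  (w.1 + w.2) * (size f).-1%:Z != D.
Proof.
have [phi ode] := leading_eigenvector.
have e : (w.1 + w.2)%:~R * (size f).-1%:R = ((w.1 + w.2) * (size f).-1%:Z)%:~R :> K.
  by rewrite rmorphM.
move=> lt; have := ode_solution f0 _ _ ode.
rewrite e -[2%:R * _](rmorphM (intr : int -> K) 2) /= ltr_int !ltr0z eqr_int.
by apply.
Qed.

End Subalgebra.

(** * Substitutions *)

Section Subst.
Variable K : numClosedFieldType.
Local Notation poly2 := {mpoly K[2]}.
Implicit Types (F G P Q sx sy : poly2).

Definition subst sx sy F : poly2 := F \mPo [tuple sx; sy].

Lemma substX sx sy k : subst sx sy 'X_[k] = sx ^+ k 0 * sy ^+ k 1.
Proof.
rewrite /subst comp_mpolyX !big_ord_recr big_ord0 /= mul1r.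
by congr (_ ^+ k _ * _ ^+ k _); apply: val_inj.
Qed.

Lemma substP sx sy c F G :
  subst sx sy (c *: F + G) = c *: subst sx sy F + subst sx sy G.
Proof. by rewrite /subst comp_mpolyD comp_mpolyZ. Qed.

Lemma substD sx sy F G : subst sx sy (F + G) = subst sx sy F + subst sx sy G.
Proof. exact: comp_mpolyD. Qed.

Lemma substB sx sy F G : subst sx sy (F - G) = subst sx sy F - subst sx sy G.
Proof. exact: comp_mpolyB. Qed.

Lemma substM sx sy F G : subst sx sy (F * G) = subst sx sy F * subst sx sy G.
Proof. by rewrite /subst rmorphM. Qed.

Lemma substC sx sy c : subst sx sy c%:MP = c%:MP.
Proof. exact: comp_mpolyC. Qed.

Lemma mpolyX2 k : 'X_[k] = 'X_0 ^+ k 0 * 'X_1 ^+ k 1 :> poly2.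
Proof.
rewrite mpolyXE_id !big_ord_recr big_ord0 /= mul1r.
congr ('X__ ^+ k _ * 'X__ ^+ k _); exact: val_inj.
Qed.

Lemma mpoly2_ind (P : poly2 -> Prop) : (forall c, P c%:MP) -> P 'X_0 -> P 'X_1 ->
  (forall F G, P F -> P G -> P (F + G)) -> (forall F G, P F -> P G -> P (F * G)) ->
  forall F, P F.
Proof.
move=> PC P0 P1 PD PM; have PE F n : P F -> P (F ^+ n).
  move=> PF; elim: n => [|n IH]; first by rewrite expr0 -mpolyC1.
  by rewrite exprS; apply: PM.
apply: mpoly_linear_ind => [k|c F G PF PG].
  by rewrite mpolyX2; apply: PM; apply: PE.
by apply: PD => //; rewrite -mul_mpolyC; apply: PM.
Qed.

Lemma substX0 sx sy : subst sx sy 'X_0 = sx.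
Proof. exact: comp_mpolyXU. Qed.

Lemma substX1 sx sy : subst sx sy 'X_1 = sy.
Proof. exact: comp_mpolyXU. Qed.

Lemma mderivXU c i : (mpolyX K U_(c%R))^`M(i) = (c == i)%:R%:MP :> poly2.
Proof.
rewrite mderivX mnm1E; case: eqP => [->|_]; last by rewrite scale0r mpolyC0.
rewrite (_ : U_(i) - U_(i) = 0)%MM ?mpolyX0 ?scale1r ?mpolyC1 //.
by apply/mnmP => j; rewrite mnmBE subnn mnm0E.
Qed.

Lemma mderiv_subst sx sy F i : (subst sx sy F)^`M(i) =
  subst sx sy F^`M(0) * sx^`M(i) + subst sx sy F^`M(1) * sy^`M(i).
Proof.
elim/mpoly2_ind: F => [c|||F G IF IG|F G IF IG].
- by rewrite substC !mderivC -mpolyC0 substC mpolyC0 !mul0r addr0.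
- by rewrite substX0 !mderivXU !substC mpolyC1 mpolyC0 mul1r mul0r addr0.
- by rewrite substX1 !mderivXU !substC mpolyC1 mpolyC0 mul1r mul0r add0r.
- by rewrite !(substD, mderivD) IF IG; ring.
by rewrite !(substM, mderivM, substD) IF IG; ring.
Qed.

Lemma bracket_subst sx sy F G :
  bracket (subst sx sy F) (subst sx sy G) =
    subst sx sy (bracket F G) * bracket sx sy.
Proof.
by rewrite /bracket !mderiv_subst substB !substM; ring.
Qed.

Lemma degle1 w : degle w 0 (1 : poly2).
Proof. by rewrite -mpolyC1; exact: degleC. Qed.

Lemma lead1 w : lead w 0 (1 : poly2) = 1.
Proof. by rewrite -mpolyX0 leadX wt0 eqxx mnm0E expr0. Qed.

Lemma lead_exp w D F n : degle w D F ->
  lead w (D * n%:Z) (F ^+ n) = lead w D F ^+ n.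
Proof.
move=> dF; elim: n => [|n IH]; first by rewrite mulr0 !expr0 lead1.
rewrite !exprS (_ : D * n.+1%:Z = D + D * n%:Z); last by lia.
by rewrite leadM ?IH //; exact: degleXn.
Qed.

Lemma subst_sum sx sy (I : Type) (r : seq I) (P : pred I) (F : I -> poly2) :
  subst sx sy (\sum_(i <- r | P i) F i) = \sum_(i <- r | P i) subst sx sy (F i).
Proof. exact: (linear_sum (comp_mpoly [tuple sx; sy])). Qed.

Lemma substZ sx sy c F : subst sx sy (c *: F) = c *: subst sx sy F.
Proof. exact: comp_mpolyZ. Qed.

Section WeightedSubst.
Variables (w u : int * int) (sx sy : poly2).
Hypothesis dx : degle u w.1 sx.
Hypothesis dy : degle u w.2 sy.

Let degle_substX k : degle u (wt w k) (subst sx sy 'X_[k]).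
Proof. by rewrite substX /wt; apply: degleM; apply: degleXn. Qed.

Lemma degle_subst D F : degle w D F -> degle u D (subst sx sy F).
Proof.
move=> dF; rewrite (mpolyE F) subst_sum big_seq.
apply: degle_sum => k kF; rewrite substZ; apply: degleZ.
exact: degle_le (dF k kF) (@degle_substX k).
Qed.

(** If the images of x and y have weights at most those of x and y, only the
monomials of top weight of F contribute to the top weight after
substitution, through the leading forms of these images. *)
Lemma lead_subst D F : degle w D F -> lead u D (subst sx sy F) =
  \sum_(k <- msupp F | wt w k == D)
    F@_k *: (lead u w.1 sx ^+ k 0 * lead u w.2 sy ^+ k 1).
Proof.
move=> dF; rewrite {1}(mpolyE F) subst_sum (linear_sum (lead u D)) /=.
rewrite [RHS]big_mkcond; apply: eq_big_seq => k kF; rewrite substZ linearZ /=.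
case: eqP => [e|ne]; last first.
  rewrite (lead_gt (@degle_substX k)) ?scaler0 //.
  by rewrite lt_neqAle dF // andbT; apply/eqP.
by rewrite substX -e /wt leadM ?lead_exp //; exact: degleXn.
Qed.

Lemma lead_subst_comp D F : degle w D F -> lead u w.2 sy = 1 ->
  lead u D (subst sx sy F) = lead w D F \Po lead u w.1 sx.
Proof.
move=> dF ly; rewrite lead_subst // [lead w D F]/lead linear_sum /=.
apply: eq_bigr => k _; rewrite linearZ /= ly expr1n mulr1.
by rewrite rmorphXn /= comp_polyX.
Qed.

End WeightedSubst.

Definition shear (a : K) (k : nat) F : poly2 :=
  subst ('X_0 + a *: 'X_1 ^+ k) 'X_1 F.

Lemma degleX0 w : degle w w.1 ('X_0 : poly2).
Proof. by have := @degleX K w U_(0%R); rewrite /wt !mnm1E /= mulr1 mulr0 addr0. Qed.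

Lemma degleX1 w : degle w w.2 ('X_1 : poly2).
Proof. by have := @degleX K w U_(1%R); rewrite /wt !mnm1E /= mulr1 mulr0 add0r. Qed.

Lemma leadX0 w : lead w w.1 ('X_0 : poly2) = 'X.
Proof. by rewrite leadX /wt !mnm1E /= mulr1 mulr0 addr0 eqxx expr1. Qed.

Lemma leadX1 w : lead w w.2 ('X_1 : poly2) = 1.
Proof. by rewrite leadX /wt !mnm1E /= mulr1 mulr0 add0r eqxx expr0. Qed.

Lemma degle_shear w D a k F : k%:Z * w.2 <= w.1 -> degle w D F ->
  degle w D (shear a k F).
Proof.
move=> kw dF; apply: (degle_subst _ _ dF); last exact: degleX1.
apply: degleD; [exact: degleX0|apply: degleZ].
by apply: degle_le (degleXn (degleX1 w)); rewrite mulrC.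
Qed.

(** If w.1 = k w.2, the substitution x + a y^k is homogeneous, and at y = 1 it is
the translation by a. *)
Lemma lead_shear w D a k F : w.1 = k%:Z * w.2 -> degle w D F ->
  lead w D (shear a k F) = lead w D F \Po ('X + a%:P).
Proof.
move=> kw dF; rewrite (@lead_subst_comp w) ?leadX1 //; last exact: degleX1.
  congr (_ \Po _); rewrite linearD linearZ /= leadX0.
  by rewrite kw mulrC lead_exp ?leadX1 ?expr1n ?alg_polyC //; exact: degleX1.
apply: degleD; [exact: degleX0|apply: degleZ].
by rewrite kw mulrC; apply: degleXn; exact: degleX1.
Qed.

Definition jacpair F G := exists2 c : K, c != 0 & bracket F G = c%:MP.

Lemma jacpair_subst sx sy d F G : d != 0 -> bracket sx sy = d%:MP -> jacpair F G ->
  jacpair (subst sx sy F) (subst sx sy G).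
Proof.
move=> d0 ds [c c0 e]; exists (c * d); first by rewrite mulf_neq0.
by rewrite bracket_subst e substC ds -mpolyCM.
Qed.

Lemma bracketX01 : bracket 'X_0 'X_1 = 1 :> poly2.
Proof. by rewrite /bracket !mderivXU !eqxx mulr1 mpolyC0 mulr0 subr0 mpolyC1. Qed.

Lemma jacpair_shear a k F G : jacpair F G -> jacpair (shear a k F) (shear a k G).
Proof.
apply: (jacpair_subst (oner_neq0 _)).
have z : bracket ('X_1 ^+ k) 'X_1 = 0 :> poly2.
  elim: k => [|k IH]; first by rewrite expr0 bracket_sym -mpolyC1 bracketC oppr0.
  rewrite exprS bracket_sym bracketMr bracket_self mul0r add0r bracket_sym IH.
  by rewrite oppr0 mulr0 oppr0.
rewrite bracket_sym bracketDr bracketZr bracket_sym bracketX01.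
rewrite [bracket 'X_1 _]bracket_sym z.
by rewrite oppr0 scaler0 addr0 opprK mpolyC1.
Qed.
End Subst.

(** * Edges *)

(** The pair of largest slope d.2 / d.1, if it is positive, provides p / q. Here
d.1 is the loss of a point against the vertex for the old weight and d.2 its
gain for the new one, and p / q tells when the first point catches up. *)
Lemma max_slope (L : seq (int * int)) : {in L, forall d, 0 < d.1} ->
  {in L, forall d, d.2 <= 0} \/
  exists p q : int, [/\ 0 < p, 0 < q, {in L, forall d, q * d.2 <= p * d.1} &
    exists2 d, d \in L & q * d.2 = p * d.1].
Proof.
elim: L => [|d L IH] L0; first by left.
have d0 : 0 < d.1 by apply: L0; rewrite mem_head.
have {}L0 e : e \in L -> 0 < e.1 by move=> eL; apply: L0; rewrite inE eL orbT.
have [le|[p [q [p0 q0 le [e eL ee]]]]] := IH L0.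
  have [d2|d2] := leP d.2 0.
    by left=> e; rewrite inE => /orP [/eqP ->|/le].
  right; exists d.2, d.1; split=> //.
    move=> e; rewrite inE => /orP [/eqP ->|eL]; first by rewrite mulrC.
    apply: (@le_trans _ _ 0); first by rewrite mulr_ge0_le0 ?le // ltW.
    by rewrite mulr_ge0 // ltW // L0.
  by exists d; rewrite ?mem_head // mulrC.
have [dle|dgt] := leP (q * d.2) (p * d.1).
  right; exists p, q; split=> //; last by exists e; rewrite // inE eL orbT.
  by move=> x; rewrite inE => /orP [/eqP ->|/le].
have d2 : 0 < d.2.
  by rewrite -(pmulr_rgt0 _ q0); apply: lt_trans dgt; rewrite mulr_gt0.
right; exists d.2, d.1; split=> //; last by exists d; rewrite ?mem_head // mulrC.
move=> x; rewrite inE => /orP [/eqP ->|xL]; first by rewrite mulrC.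
have x0 := L0 x xL; have xle := le x xL.
rewrite -(ler_pM2l q0).
apply: (@le_trans _ _ (d.1 * (p * x.1))).
  by rewrite mulrCA ler_pM2l.
by rewrite [X in _ <= X]mulrA mulrCA [X in X <= _]mulrA ler_pM2r // ltW // mulrC.
Qed.

Section Edges.
Variable K : numClosedFieldType.
Local Notation poly2 := {mpoly K[2]}.
Implicit Types (F G P Q : poly2) (w : int * int) (D : int) (v : 'X_{1..2}).

(** The leading form of F for the weight w is a monomial, with exponent v. *)
Definition top w F v : Prop :=
  v \in msupp F /\ {in msupp F, forall k, k != v -> wt w k < wt w v}.

Lemma top_degle w F v : top w F v -> degle w (wt w v) F.
Proof. by move=> [_ lt] k kF; have [->//|/(lt k kF)/ltW] := eqVneq k v. Qed.

Definition on_edge w F v : Prop :=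
  exists2 k, k \in msupp F & k != v /\ wt w k = wt w v.

Definition comb (p q : int) (w0 w1 : int * int) : int * int :=
  (p * w0.1 + q * w1.1, p * w0.2 + q * w1.2).

Lemma wt_comb p q w0 w1 k : wt (comb p q w0 w1) k = p * wt w0 k + q * wt w1 k.
Proof. by rewrite /wt /comb /=; ring. Qed.

(** While the weight turns from w0 to w1, the vertices v and v' remain leading,
unless the weight reaches the first direction in which a second point of F or of
G catches up with its vertex. *)
Lemma rotate w0 w1 F G v v' : top w0 F v -> top w0 G v' ->
  (degle w1 (wt w1 v) F /\ degle w1 (wt w1 v') G) \/
  exists p q, let w := comb p q w0 w1 in
    [/\ 0 < p, 0 < q, degle w (wt w v) F, degle w (wt w v') G &
        on_edge w F v \/ on_edge w G v'].
Proof.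
move=> [vF tF] [vG tG].
pose dif u k := (wt w0 u - wt w0 k, wt w1 k - wt w1 u).
pose L := [seq dif v k | k <- msupp F & k != v] ++
  [seq dif v' k | k <- msupp G & k != v'].
have L0 : {in L, forall d, 0 < d.1}.
  move=> d; rewrite mem_cat.
  move=> /orP [] /mapP [k]; rewrite mem_filter => /andP [kv kF] -> /=.
    by rewrite subr_gt0 tF.
  by rewrite subr_gt0 tG.
have LF k : k \in msupp F -> k != v -> dif v k \in L.
  by move=> kF kv; rewrite mem_cat map_f // mem_filter kv.
have LG k : k \in msupp G -> k != v' -> dif v' k \in L.
  by move=> kF kv; rewrite mem_cat orbC map_f // mem_filter kv.
have [le|[p [q [p0 q0 le [d dL de]]]]] := max_slope L0.
  left; split=> k kF.
    by have [->//|kv] := eqVneq k v; have := le _ (LF k kF kv); rewrite subr_le0.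
  by have [->//|kv] := eqVneq k v'; have := le _ (LG k kF kv); rewrite subr_le0.
right; exists p, q => w; split=> //.
- move=> k kF; have [->//|kv] := eqVneq k v.
  by have := le _ (LF k kF kv); rewrite !wt_comb /=; lia.
- move=> k kF; have [->//|kv] := eqVneq k v'.
  by have := le _ (LG k kF kv); rewrite !wt_comb /=; lia.
move: dL; rewrite mem_cat.
move=> /orP [] /mapP [k]; rewrite mem_filter => /andP [kv kF] ed.
  by left; exists k => //; split=> //; move: de; rewrite ed !wt_comb /=; lia.
by right; exists k => //; split=> //; move: de; rewrite ed !wt_comb /=; lia.
Qed.

Lemma power_deriv (f : {poly K}) c rho m : f = c%:P * ('X - rho%:P) ^+ m ->
  ('X - rho%:P) * f^`() = m%:R%:P * f.
Proof.
rewrite mulrC => ->.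
by rewrite XsubC_deriv derivC mulr0 addr0 mulrCA.
Qed.

(** The bracket [F, G] has weight 0, less than D + D' - (w.1 + w.2), so the
leading forms commute. As that of F is a constant times (X - rho)^m, commuting
is a first order equation for that of G, which [power_of_linear] solves. *)
Lemma edge_powers (a b : nat) F G w (D D' : int) : jacpair F G ->
  (0 < a)%N -> 0 < w.2 -> 0 < w.1 + w.2 -> 0 < D -> w.1 + w.2 < D + D' ->
  degle w D F -> lead w D F != 0 -> degle w D' G -> lead w D' G != 0 ->
  b%:Z * D = a%:Z * D' ->
  (w.1 + w.2) * (size (lead w D F)).-1%:Z < 2 * D ->
  exists rho c c' m m', [/\ c != 0 /\ c' != 0,
    lead w D F = c%:P * ('X - rho%:P) ^+ m,
    lead w D' G = c'%:P * ('X - rho%:P) ^+ m',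
    (b * m = a * m')%N & (w.1 + w.2) * m%:Z != D].
Proof.
move=> [c0 c00 jFG] a0 w2 w12 D0 DD' dF lF dG lG bD lt.
have [[rho ef] neD] := leading_form_power jFG c00 w2 w12 D0 dF lF lt.
have [_] := lead_bracket dF dG.
rewrite jFG (lead_gt (@degleC K w c0)) ?subr_gt0 // scaler0.
set f := lead w D F in lF ef neD lt *; set g := lead w D' G in lG *.
set m := (size f).-1 in ef neD lt.
rewrite -!mul_polyC => /esym/eqP; rewrite subr_eq0 => /eqP com.
have fX := power_deriv ef.
have eg : (D'%:~R * m%:R)%:P * g = D%:~R%:P * (('X - rho%:P) * g^`()).
  apply: (mulfI lF); transitivity (D'%:~R%:P * ((m%:R%:P * f) * g)).
    by rewrite rmorphM /=; ring.
  rewrite -fX.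
  transitivity (('X - rho%:P) * (D'%:~R%:P * (f^`() * g))); first by ring.
  by rewrite com; ring.
have D00 : D%:~R != 0 :> K by rewrite intr_eq0 gt_eqF.
exists rho, (lead_coef f), (lead_coef g), m, (size g).-1; split=> //.
- by rewrite !lead_coef_eq0.
- exact: power_of_linear lG D00 eg.
have := @top_relation _ (D'%:~R * m%:R) D%:~R ('X - rho%:P) g
  (negbT (polyXsubC_eq0 _)) lG.
rewrite derivXsubC mul1r => /(_ eg); rewrite size_XsubC /= mulr1.
rewrite -[X in _ * X = _]/((_%:Z)%:~R) -[X in _ = _ * X]/((_%:Z)%:~R) -!rmorphM /=.
move/eqP; rewrite eqr_int => /eqP e.
have : D * (b * m)%:Z = D * (a * (size g).-1)%:Z.
  rewrite !PoszM; transitivity ((b%:Z * D) * m%:Z); first by ring.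
  by rewrite bD -mulrA e; ring.
by move/(mulfI (lt0r_neq0 D0)) => -[].
Qed.

Lemma lead_monomial w D F c m k : w.2 != 0 -> lead w D F = c%:P * 'X^m ->
  k \in msupp F -> wt w k = D -> k 0 = m.
Proof.
move=> w2 lF kF e; apply/eqP; move: kF; rewrite mcoeff_msupp -(coef_lead F w2 e) lF.
by rewrite coefCM coefXn; case: (k 0 == m); rewrite // mulr0 eqxx.
Qed.

Lemma lead_coef_point w D F i : w.2 != 0 -> (lead w D F)`_i != 0 ->
  exists j, mn i j \in msupp F /\ wt w (mn i j) = D.
Proof.
move=> w2 ne; have [j e] := coef_lead_neq0 ne.
by exists j; rewrite mcoeff_msupp -(coef_lead_mn F w2 e).
Qed.

Lemma top_of_lead w D F c m : w.2 != 0 -> c != 0 -> degle w D F ->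
  lead w D F = c%:P * 'X^m -> exists j, wt w (mn m j) = D /\ top w F (mn m j).
Proof.
move=> w2 c0 dF lF.
have [|j [jF e]] := @lead_coef_point w D F m w2.
  by rewrite lF coefCM coefXn eqxx mulr1.
exists j; split=> //; split=> // k kF kj; rewrite lt_neqAle e dF // andbT.
apply: contra_neq kj => ek; apply: (wt_inj w2); first by rewrite ek.
by rewrite mnE0 (lead_monomial w2 lF kF ek).
Qed.

Lemma top_scale k t F v : 0 < t -> top (k * t, t) F v -> top (k, 1) F v.
Proof.
move=> t0; have e u : wt (k * t, t) u = t * wt (k, 1) u by rewrite /wt /=; ring.
by move=> [vF tF]; split=> // u uF uv; have := tF u uF uv; rewrite !e ltr_pM2l.
Qed.

(** The leading forms are multiples of (X - rho)^m and (X - rho)^m' by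
[edge_powers]; when one of them is not a monomial, rho <> 0 and m > 0. Then the
coefficients of x^0 and x^1 do not vanish, and the corresponding points (0, j0)
and (1, j1) have the same weight, whence w.1 = (j0 - j1) w.2. For
k = j0 - j1 >= 0, the shear by rho y^k moves the root rho to 0. *)
Lemma edge_step (a b : nat) F G w (x y x' y' : nat) : jacpair F G ->
  (0 < a)%N -> (0 < b)%N -> 0 < w.2 -> 0 < w.1 + w.2 ->
  let v := mn x y in let v' := mn x' y' in
  v \in msupp F -> v' \in msupp G -> degle w (wt w v) F -> degle w (wt w v') G ->
  (b * x = a * x')%N -> (b * y = a * y')%N ->
  on_edge w F v \/ on_edge w G v' ->
  0 < wt w v -> w.1 + w.2 < wt w v + wt w v' ->
  {in msupp F, forall k, wt w k = wt w v -> (w.1 + w.2) * (k 0)%:Z < 2 * wt w v} ->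
  exists (rho : K) (k : int) (m j m' j' : nat), [/\ rho != 0 /\ w.1 = k * w.2,
    [/\ (0 < m)%N, mn m j \in msupp F, wt w (mn m j) = wt w v &
       {in msupp F, forall k, wt w k = wt w v -> (k 0%R <= m)%N}],
    exists2 j0, mn 0 j0 \in msupp F & wt w (mn 0 j0) = wt w v,
    (b * m = a * m')%N /\ (b * j = a * j')%N &
    forall n : nat, k = n%:Z -> top (n%:Z, 1) (shear rho n F) (mn m j) /\
      top (n%:Z, 1) (shear rho n G) (mn m' j')].
Proof.
move=> jFG a0 b0 w2 w12 v v' vF v'G dF dG e0 e1 edge D0 DD' half.
set D := wt w v in dF D0 DD' half *; set D' := wt w v' in dG DD' *.
have w20 : w.2 != 0 by rewrite gt_eqF.
have bD : b%:Z * D = a%:Z * D'.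
  rewrite /D /D' !wt_mn !mulrDr !(mulrCA _ w.1) !(mulrCA _ w.2) -!PoszM.
  by rewrite e0 e1.
have nz u (H : poly2) : u \in msupp H -> lead w (wt w u) H != 0.
  move=> uH; apply/eqP => z; have := coef_lead H w20 (erefl (wt w u)).
  by rewrite z coef0 => /esym/eqP; rewrite mcoeff_eq0 uH.
have lF := nz _ _ vF; have lG := nz _ _ v'G.
have lt : (w.1 + w.2) * (size (lead w D F)).-1%:Z < 2 * D.
  have [|j [jF ej]] := @lead_coef_point w D F (size (lead w D F)).-1 w20.
    by rewrite -lead_coefE lead_coef_eq0.
  by have := half _ jF ej; rewrite mnE0.
have [rho [c [c' [m [m' [[c0 c'0] eF eG bm _]]]]]] :=
  edge_powers jFG a0 w2 w12 D0 DD' dF lF dG lG bD lt.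
have [rho0 m0] : rho != 0 /\ (0 < m)%N.
  have mono : rho = 0 \/ m = 0%N -> False.
    move=> h.
    have [lF' lG'] : lead w D F = c%:P * 'X^m /\ lead w D' G = c'%:P * 'X^m'.
      rewrite eF eG; case: h => [->|mz]; first by rewrite subr0.
      have -> : m' = 0%N by move: bm; rewrite mz; nia.
      by rewrite mz !expr0.
    case: edge => [] [k kH [kv ek]]; case/eqP: kv; apply: (wt_inj w20 ek).
      by rewrite (lead_monomial w20 lF' kH ek) (lead_monomial w20 lF' vF).
    by rewrite (lead_monomial w20 lG' kH ek) (lead_monomial w20 lG' v'G).
  split; first by apply/eqP => z; apply: mono; left.
  by rewrite lt0n; apply/eqP => z; apply: mono; right.
have size_f : size (lead w D F) = m.+1.
  by rewrite eF size_Cmul // size_exp_XsubC.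
have lc_f : (lead w D F)`_m = c.
  have := lead_coefE (lead w D F); rewrite size_f => <-.
  by rewrite eF lead_coefM lead_coefC lead_coef_exp lead_coefXsubC expr1n mulr1.
have [|j [jF ej]] := @lead_coef_point w D F m w20; first by rewrite lc_f.
have [|j0 [j0F ej0]] := @lead_coef_point w D F 0 w20.
  rewrite -horner_coef0 eF hornerCM horner_exp hornerXsubC mulf_neq0 //.
  by rewrite expf_neq0 // sub0r oppr_eq0.
have [|j1 [j1F ej1]] := @lead_coef_point w D F 1 w20.
  rewrite -[_`_1]mulr1n -coef_deriv -horner_coef0 eF derivM derivC mul0r add0r.
  rewrite deriv_exp derivXsubC mul1r hornerCM hornerMn horner_exp hornerXsubC.
  by rewrite mulf_neq0 // mulrn_eq0 negb_or -lt0n m0 expf_neq0 // sub0r oppr_eq0.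
have kE : w.1 = (j0%:Z - j1%:Z) * w.2.
  by move: ej0; rewrite -ej1 !wt_mn; lia.
have ej' : exists j', wt w (mn m' j') = D' /\ (b * j = a * j')%N.
  have [|j' [_ ej']] := @lead_coef_point w D' G m' w20.
    have := lead_coef_eq0 (lead w D' G).
    rewrite lead_coefE eG size_Cmul // size_exp_XsubC /= => ->.
    by rewrite mulf_neq0 ?polyC_eq0 // expf_neq0 // polyXsubC_eq0.
  exists j'; split=> //; move: bD; rewrite -ej -ej' !wt_mn => bD.
  have : w.2 * (b * j)%:Z = w.2 * (a * j')%:Z.
    have : w.1 * (b * m)%:Z = w.1 * (a * m')%:Z by rewrite bm.
    rewrite !PoszM; move: bD; rewrite !mulrDr !(mulrCA b%:Z) !(mulrCA a%:Z); lia.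
  by move/(mulfI w20) => -[].
have [j' [ej'D bj]] := ej'.
exists rho, (j0%:Z - j1%:Z), m, j, m', j'; split=> //.
- split=> // k kF ek; rewrite -ltnS -size_f ltnNge; apply/negP => /(nth_default 0).
  by rewrite (coef_lead F w20 ek) => /eqP; rewrite mcoeff_eq0 kF.
- by exists j0.
move=> n kn; rewrite kn in kE.
have ew : w = (n%:Z * w.2, w.2) by rewrite -kE; case: (w).
have tr E (H : poly2) (d : K) i l : degle w E H -> d != 0 ->
    lead w E H = d%:P * ('X - rho%:P) ^+ i ->
    wt w (mn i l) = E -> top (n%:Z, 1) (shear rho n H) (mn i l).
  move=> dH d0 eH el; apply: (@top_scale _ w.2) => //; rewrite -ew.
  have := @top_of_lead w E (shear rho n H) d i w20 d0.
  case.
  - by apply: degle_shear => //; rewrite kE.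
  - rewrite lead_shear // eH rmorphM rmorphXn /=.
    by rewrite comp_polyC comp_polyB comp_polyX comp_polyC addrK.
  move=> l' [el' t]; suff -> : l = l' by [].
  by move: el'; rewrite -el !wt_mn => /addrI/(mulfI w20) => -[].
by split; [apply: (tr D) eF _ | apply: (tr D') eG _].
Qed.
End Edges.

(** * Reduction to a corner *)

Section Reduction.
Variable K : numClosedFieldType.
Local Notation poly2 := {mpoly K[2]}.
Implicit Types (F G P Q : poly2) (w : int * int) (D : int) (v : 'X_{1..2}).
Variables a b : nat.
Hypothesis a2 : (2 <= a)%N.
Hypothesis ab : (a < b)%N.
Hypothesis cop : coprime a b.

Let a0 : (0 < a)%N. Proof. exact: ltnW. Qed.
Let b0 : (0 < b)%N. Proof. exact: leq_ltn_trans ab. Qed.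

(** Since a and b are coprime, b m = a m' makes m a multiple of a. *)
Lemma ratio_ge2 m m' : (b * m = a * m')%N -> (0 < m)%N -> (2 <= m)%N /\ (m < m')%N.
Proof.
move=> e m0; split; last first.
  by rewrite -(ltn_pmul2l a0) -e ltn_pmul2r.
have : (a %| b * m)%N by rewrite e dvdn_mulr.
by rewrite Gauss_dvdr // => /(dvdn_leq m0); apply: leq_trans.
Qed.

Lemma ratio_lt m m' n n' : (b * m = a * m')%N -> (b * n = a * n')%N ->
  (m < n)%N -> (m' < n')%N.
Proof. by move=> em en lt; rewrite -(ltn_pmul2l a0) -em -en ltn_pmul2l. Qed.

(** For w.1 > w.2 the inequality required by [edge_step] always holds, as
D >= w.1 (k 0). *)
Lemma half_steep w D (k : 'X_{1..2}) :
  0 < w.2 -> w.2 < w.1 -> 0 < D -> wt w k = D ->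
  (w.1 + w.2) * (k 0)%:Z < 2 * D.
Proof.
move=> w2 w12 D0; rewrite /wt => e.
have [->|k0] := posnP (k 0); first by rewrite mulr0 mulr_gt0.
have : (w.1 + w.2) * (k 0)%:Z < 2 * w.1 * (k 0)%:Z.
  by rewrite ltr_pM2r ?ltz_nat //; lia.
move/lt_le_trans; apply; rewrite -mulrA ler_pM2l // -e lerDl.
by rewrite mulr_ge0 // ltW.
Qed.

Definition below_corner F m n : Prop := mn m n \in msupp F /\
  {in msupp F, forall k : 'X_{1..2}, (k 0%R <= m)%N /\ (k 1%R + m <= n + k 0%R)%N}.

Definition normal_pair F G : Prop := exists m n m' n', [/\ jacpair F G,
  (0 < m)%N /\ (m < n)%N, (b * m = a * m')%N /\ (b * n = a * n')%N,
  below_corner F m n & below_corner G m' n'].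

Lemma degle_x F m : degle (1, 0) m%:Z F ->
  {in msupp F, forall k : 'X_{1..2}, (k 0%R <= m)%N}.
Proof. by move=> dF k /dF; rewrite /wt /= mul1r mul0r addr0. Qed.

Lemma below_cornerI F w m n : top w F (mn m n) -> degle (1, 0) m%:Z F ->
  degle (-1, 1) (wt (-1, 1) (mn m n)) F -> below_corner F m n.
Proof.
move=> [vF _] dx d; split=> // k kF; split; first exact: degle_x dx k kF.
by have := d k kF; rewrite wt_mn /wt /=; lia.
Qed.

(** For an edge met on the way from (1, 1) to (1, 0), [edge_step] yields a point
(0, j0) of the same weight as (m, n). Such a weight favours x, so that
j0 > m + n, against the total degree. *)
Lemma right_bounded F G m n m' n' : jacpair F G ->
  top (1, 1) F (mn m n) -> top (1, 1) G (mn m' n') -> (0 < m)%N -> (m < n)%N ->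
  (b * m = a * m')%N -> (b * n = a * n')%N ->
  degle (1, 0) m%:Z F /\ degle (1, 0) m'%:Z G.
Proof.
move=> jFG tF tG m0 mn0 em en.
have [|[p [q /= [p0 q0 dF dG edge]]]] := rotate (1, 0) tF tG.
  by rewrite !wt_mn /= !mul1r !mul0r !addr0.
exfalso; set w := comb p q _ _ in dF dG edge.
have [w1 w2] : w.1 = p + q /\ w.2 = p by rewrite /w /comb /=; split; ring.
have [m2 mm'] := ratio_ge2 em m0.
have D0 : w.1 + w.2 < wt w (mn m n).
  by rewrite wt_mn w1 w2; nia.
have D0' : 0 < wt w (mn m' n').
  by rewrite wt_mn w1 w2; nia.
have w2_gt : 0 < w.2 by rewrite w2.
have w12_gt : 0 < w.1 + w.2 by rewrite w1 w2; lia.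
have [|||] := edge_step jFG a0 b0 w2_gt w12_gt (proj1 tF) (proj1 tG) dF dG
  em en edge.
- exact: lt_trans D0.
- by rewrite -[X in X < _]addr0 ltrD.
- move=> k kF e; apply: (half_steep _ _ _ e) => //; last exact: lt_trans D0.
  by rewrite w1 w2 ltrDl.
move=> rho [k [m1 [j1 [m1' [j1' [_ _ [j0 j0F ej0] _ _]]]]]].
have := top_degle tF j0F; move: ej0; rewrite !wt_mn w1 w2 /=; nia.
Qed.

(** A weight (s, t) met on the way to (-1, 1) satisfies t > 0 and s + t > 0, so
m < n gives s m + t n > (s + t) m, as [edge_step] requires. The integer
k = s / t lies strictly between -1 and 1, so the edge is horizontal and k = 0;
if the weight starts at (0, 1), then s < 0 and there is no edge at all. *)
Lemma left_bounded w0 F G m n m' n' : jacpair F G ->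
  top w0 F (mn m n) -> top w0 G (mn m' n') -> (0 < m)%N -> (m < n)%N ->
  (b * m = a * m')%N -> (b * n = a * n')%N ->
  degle (1, 0) m%:Z F -> 0 < w0.2 -> 0 <= w0.1 -> w0.1 <= w0.2 ->
  (degle (-1, 1) (wt (-1, 1) (mn m n)) F /\
   degle (-1, 1) (wt (-1, 1) (mn m' n')) G) \/
  exists rho, [/\ 0 < w0.1, top (0, 1) (shear rho 0 F) (mn m n) &
                 top (0, 1) (shear rho 0 G) (mn m' n')].
Proof.
move=> jFG tF tG m0 mn0 em en dx w02 w01 w012.
have [|[p [q /= [p0 q0 dF dG edge]]]] := rotate (-1, 1) tF tG; first by left.
right; set w := comb p q _ _ in dF dG edge.
have [w1 w2] : w.1 = p * w0.1 - q /\ w.2 = p * w0.2 + q.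
  by rewrite /w /comb /=; split; ring.
have mn' := ratio_lt em en mn0.
have w2_gt : 0 < w.2 by rewrite w2; nia.
have w12_gt : 0 < w.1 + w.2 by rewrite w1 w2; nia.
have D0 : (w.1 + w.2) * m%:Z < wt w (mn m n).
  rewrite wt_mn (_ : _ + w.2 * n%:Z =
    (w.1 + w.2) * m%:Z + w.2 * (n%:Z - m%:Z)); last by ring.
  by rewrite ltrDl mulr_gt0 // subr_gt0 ltz_nat.
have D0' : 0 <= wt w (mn m' n').
  rewrite wt_mn (_ : _ + w.2 * n'%:Z =
    (w.1 + w.2) * m'%:Z + w.2 * (n'%:Z - m'%:Z)); last by ring.
  by rewrite addr_ge0 // mulr_ge0 // ?ltW // subr_gt0 ltz_nat.
have D1 : w.1 + w.2 < wt w (mn m n).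
  by apply: le_lt_trans D0; rewrite -[X in X <= _]mulr1 ler_pM2l // lez_nat.
have [|||] := edge_step jFG a0 b0 w2_gt w12_gt (proj1 tF) (proj1 tG) dF dG
  em en edge.
- exact: lt_trans D1.
- by rewrite -[X in X < _]addr0 ltr_leD.
- move=> k kF _; have /= k0 := degle_x dx kF.
  have : (w.1 + w.2) * (k 0)%:Z <= (w.1 + w.2) * m%:Z.
    by rewrite ler_pM2l // lez_nat.
  by lia.
move=> rho [k [m1 [j1 [m1' [j1' [[_ ek] [_ m1F em1 mmax] _ [bm bj] sh]]]]]].
have k0 : k = 0.
  move: ek; rewrite w1 w2 => ek.
  have : k < 1 by rewrite -(ltr_pM2r w2_gt) -w2 in ek *; nia.
  have : -1 < k by nia.
  lia.
have w10 : w.1 = 0 by rewrite ek k0 mul0r.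
have m1m : m1 = m.
  have := mmax _ (proj1 tF) (erefl _); have := degle_x dx m1F; rewrite !mnE0; lia.
have j1n : j1 = n.
  move: em1; rewrite m1m !wt_mn => /addrI/(mulfI (lt0r_neq0 w2_gt)) => -[] //.
have [m1m' j1n'] : m1' = m' /\ j1' = n' by move: bm bj; rewrite m1m j1n em en; nia.
exists rho; have := sh 0%N k0; rewrite m1m j1n m1m' j1n' => -[]; split=> //.
by move: w10; rewrite w1; nia.
Qed.

Lemma corner_case F G m n m' n' : jacpair F G ->
  top (1, 1) F (mn m n) -> top (1, 1) G (mn m' n') -> (0 < m)%N -> (m < n)%N ->
  (b * m = a * m')%N -> (b * n = a * n')%N ->
  exists F' G', normal_pair F' G'.
Proof.
move=> jFG tF tG m0 mn0 em en.
have [dF dG] := right_bounded jFG tF tG m0 mn0 em en.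
have [[lF lG]|[rho [_ tF1 tG1]]] :=
  left_bounded jFG tF tG m0 mn0 em en dF isT isT isT.
  exists F, G, m, n, m', n'; split=> //.
    exact: below_cornerI tF dF lF.
  exact: below_cornerI tG dG lG.
have dF1 : degle (1, 0) m%:Z (shear rho 0 F) by apply: degle_shear.
have dG1 : degle (1, 0) m'%:Z (shear rho 0 G) by apply: degle_shear.
have jFG1 := jacpair_shear rho 0 jFG.
have [[lF lG]|[rho' [//]]] :=
  left_bounded jFG1 tF1 tG1 m0 mn0 em en dF1 isT isT isT.
exists (shear rho 0 F), (shear rho 0 G), m, n, m', n'; split=> //.
  exact: below_cornerI tF1 dF1 lF.
exact: below_cornerI tG1 dG1 lG.
Qed.

Lemma no_x_deriv F : degle (1, 0) 0 F -> F^`M(0) = 0.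
Proof.
move=> dF; apply/mpolyP => k; rewrite mcoeff_deriv mcoeff0.
rewrite memN_msupp_eq0 ?mul0rn //; apply/negP => /(degle_x dF).
by rewrite mnmDE mnm1E /=; lia.
Qed.

(** If no edge were met on the way to
(1, 0), neither F nor G would involve x. The weight (s, t) of the first edge has
s > t, so that k = s / t >= 2. *)
Lemma steep_case F G n n' : jacpair F G ->
  top (1, 1) F (mn 0 n) -> top (1, 1) G (mn 0 n') -> (0 < n)%N ->
  (b * n = a * n')%N ->
  exists F' G' (p m j m' j' : nat), [/\ jacpair F' G', (2 <= p)%N /\ (0 < m)%N,
    top (p%:Z, 1) F' (mn m j) /\ top (p%:Z, 1) G' (mn m' j'),
    (b * m = a * m')%N /\ (b * j = a * j')%N & (p * m + j = n)%N].
Proof.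
move=> jFG tF tG n0 en.
have [[dF dG]|[p [q /= [p0 q0 dF dG edge]]]] := rotate (1, 0) tF tG.
  rewrite !wt_mn /= mulr0 mul0r addr0 in dF dG.
  case: jFG => c c0; rewrite /bracket !no_x_deriv // !mul0r subrr => /eqP.
  by rewrite eq_sym mpolyC_eq0 (negPf c0).
set w := comb p q _ _ in dF dG edge.
have [w1 w2] : w.1 = p + q /\ w.2 = p by rewrite /w /comb /=; split; ring.
have [n2 nn'] := ratio_ge2 en n0.
have w2_gt : 0 < w.2 by rewrite w2.
have w12_gt : 0 < w.1 + w.2 by rewrite w1 w2; lia.
have eD x : wt w (mn 0 x) = p * x%:Z by rewrite wt_mn w2 mulr0 add0r.
have D0 : 2 * p <= wt w (mn 0 n) by rewrite eD mulrC ler_pM2l // lez_nat.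
have D0' : 3 * p <= wt w (mn 0 n') by rewrite eD mulrC ler_pM2l // lez_nat; lia.
have e0 : (b * 0 = a * 0)%N by rewrite !muln0.
(* a second point of the edge has positive exponent of x, hence weight >= s *)
have reach (H : poly2) x : on_edge w H (mn 0 x) -> p + q <= wt w (mn 0 x).
  move=> [k kH [kx ek]]; have k0 : (0 < k 0%R)%N.
    rewrite lt0n; apply: contra_neq kx => k0.
    by apply: (wt_inj (lt0r_neq0 w2_gt) ek); rewrite mnE0.
  rewrite -ek /wt w1 w2.
  have : p + q <= (p + q) * (k 0)%:Z.
    by rewrite -{1}[p + q]mulr1 ler_pM2l ?addr_gt0 // lez_nat.
  by move/le_trans; apply; rewrite lerDl mulr_ge0 // ltW.
have [|||] := edge_step jFG a0 b0 w2_gt w12_gt (proj1 tF) (proj1 tG) dF dG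
  e0 en edge.
- by lia.
- by rewrite w1 w2; have := D0; have := D0'; case: edge => /reach; lia.
- move=> k kF e; apply: (half_steep _ _ _ e) => //; last by lia.
  by rewrite w1 w2 ltrDl.
move=> rho [k [m [j [m' [j' [[_ ek] [m0 mF em _] _ bmj sh]]]]]].
rewrite w1 w2 in ek.
have k2 : 2 <= k by nia.
have [s es] : exists s : nat, k = s%:Z by exists `|k|%N; lia.
exists (shear rho s F), (shear rho s G), s, m, j, m', j'; split=> //.
- exact: jacpair_shear.
- by rewrite es in k2.
- exact: sh.
have : p * (s * m + j)%:Z = p * n%:Z.
  by rewrite -(eD n) -em wt_mn w1 w2 ek es PoszD PoszM; ring.
by move/(mulfI (lt0r_neq0 p0)) => -[].
Qed.

(** Turn the weight from (p, 1) to (1, 1). If there is no edge, the degree is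
m + j < p m + j. Otherwise the edge has weight (k t, t) with 2 <= k < p;
straightening it yields a vertex (m1, j1) for the weight (k, 1) with
k m1 + j1 = k m + j, and the claim follows by induction on p. *)
Lemma descent (p : nat) F G m j m' j' : jacpair F G -> (2 <= p)%N -> (0 < m)%N ->
  top (p%:Z, 1) F (mn m j) -> top (p%:Z, 1) G (mn m' j') ->
  (b * m = a * m')%N -> (b * j = a * j')%N ->
  exists F' G' (x y x' y' : nat), [/\ jacpair F' G', (x + y < p * m + j)%N,
    mn x y \in msupp F' /\ degle (1, 1) (wt (1, 1) (mn x y)) F',
    mn x' y' \in msupp G' /\ degle (1, 1) (wt (1, 1) (mn x' y')) G' &
    (b * x = a * x')%N /\ (b * y = a * y')%N].
Proof.
elim/ltn_ind: p F G m j m' j' => p IH F G m j m' j' jFG p2 m0 tF tG em ej.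
have [[dF dG]|[q0 [q /= [q00 q1 dF dG edge]]]] := rotate (1, 1) tF tG.
  exists F, G, m, j, m', j'; split=> //; last 2 first.
  - by split=> //; exact: (proj1 tF).
  - by split=> //; exact: (proj1 tG).
  by rewrite ltn_add2r -{1}[m]mul1n ltn_pmul2r.
set w := comb q0 q _ _ in dF dG edge.
have [w1 w2] : w.1 = q0 * p%:Z + q /\ w.2 = q0 + q.
  by rewrite /w /comb /=; split; ring.
have [m2 mm'] := ratio_ge2 em m0.
have w2_gt : 0 < w.2 by rewrite w2; lia.
have w21 : w.2 < w.1 by rewrite w1 w2 ltrD2r -{1}[q0]mulr1 ltr_pM2l.
have w12_gt : 0 < w.1 + w.2 by lia.
have D0 : w.1 + w.2 < wt w (mn m j).
  have : 2 * w.1 <= w.1 * m%:Z by rewrite mulrC ler_pM2l ?lez_nat //; lia.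
  have : 0 <= w.2 * j%:Z by rewrite mulr_ge0 // ltW.
  by rewrite wt_mn; lia.
have D0' : 0 <= wt w (mn m' j').
  have w1_ge : 0 <= w.1 by lia.
  by rewrite wt_mn addr_ge0 // mulr_ge0 // ltW.
have [|||] := edge_step jFG a0 b0 w2_gt w12_gt (proj1 tF) (proj1 tG) dF dG
  em ej edge.
- exact: lt_trans D0.
- by rewrite -[X in X < _]addr0 ltr_leD.
- move=> k kF e; apply: (half_steep _ _ _ e) => //; exact: lt_trans D0.
move=> rho [k [m1 [j1 [m1' [j1' [[_ ek] [m10 mF1 em1 _] _ [bm bj] sh]]]]]].
have k2 : 2 <= k by rewrite ek in w21; nia.
have kp : k < p%:Z.
  rewrite -(ltr_pM2r w2_gt) -ek w1 w2 mulrDr [p%:Z * q0]mulrC ltrD2l.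
  by rewrite -{1}[q]mul1r ltr_pM2r.
have [s es] : exists s : nat, k = s%:Z by exists `|k|%N; lia.
have [tF1 tG1] := sh s es.
have es1 : (s * m1 + j1 = s * m + j)%N.
  have : w.2 * (s * m1 + j1)%:Z = w.2 * (s * m + j)%:Z.
    by move: em1; rewrite !wt_mn ek es !PoszD !PoszM => e; rewrite !mulrDr; lia.
  by move/(mulfI (lt0r_neq0 w2_gt)) => -[].
rewrite es in kp k2.
have [F' [G' [x [y [x' [y' [jF' lt vF vG bxy]]]]]]] :=
  IH s kp _ _ _ _ _ _ (jacpair_shear rho s jFG) k2 m10 tF1 tG1 bm bj.
exists F', G', x, y, x', y'; split=> //; apply: leq_trans lt _.
by rewrite es1 leq_add2r leq_mul2r ltnW ?orbT.
Qed.

Definition swap F : poly2 := subst 'X_1 'X_0 F.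

Lemma mcoeff_swap F i j : (swap F)@_(mn i j) = F@_(mn j i).
Proof.
elim/mpoly_linear_ind: F => [k|c F G IF IG]; last first.
  by rewrite /swap substP !mcoeffD !mcoeffZ -IF -IG.
rewrite /swap substX mulrC -{1}[k 0](mnE1 (k 1)) -{1}[k 1](mnE0 _ (k 0)) -mpolyX2.
rewrite !mcoeffX; congr (nat_of_bool _)%:R; apply/eqP/eqP => [e|->].
  by rewrite -(mn_eta k); have := congr1 (fun l : 'X_{1..2} => (l 0%R, l 1%R)) e;
    rewrite !mnE0 !mnE1 => -[-> ->].
by rewrite mnE0 mnE1.
Qed.

Lemma msupp_swap F k : (k \in msupp (swap F)) = (mn (k 1) (k 0) \in msupp F).
Proof. by rewrite !mcoeff_msupp -{1}(mn_eta k) mcoeff_swap. Qed.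

Lemma degle_swap D F : degle (1, 1) D F -> degle (1, 1) D (swap F).
Proof.
by move=> dF k; rewrite msupp_swap => /dF; rewrite wt_mn /wt /= addrC.
Qed.

Lemma top_swap F i j : top (1, 1) F (mn i j) -> top (1, 1) (swap F) (mn j i).
Proof.
move=> [vF tF]; split; first by rewrite msupp_swap mnE0 mnE1.
move=> k; rewrite msupp_swap => kF kv.
have : mn (k 1) (k 0) != mn i j.
  apply: contra_neq kv => e; rewrite -(mn_eta k).
  have := congr1 (fun l : 'X_{1..2} => (l 0%R, l 1%R)) e.
  by rewrite !mnE0 !mnE1 => -[-> ->].
by move=> /(tF _ kF); rewrite !wt_mn /wt /= addrC [X in _ < X]addrC.
Qed.

Lemma jacpair_swap F G : jacpair F G -> jacpair (swap F) (swap G).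
Proof.
have : bracket 'X_1 'X_0 = (-1)%:MP :> poly2.
  by rewrite bracket_sym bracketX01 mpolyCN mpolyC1.
by apply: jacpair_subst; rewrite oppr_eq0 oner_neq0.
Qed.

Definition has_deg F (d : nat) : Prop := degle (1, 1) d%:Z F /\
  exists2 v, v \in msupp F & wt (1, 1) v = d%:Z.

Lemma has_deg_lead F d : has_deg F d -> lead (1, 1) d%:Z F != 0.
Proof.
move=> [_ [v vF e]]; apply: contraTneq vF => z.
by rewrite -mcoeff_eq0 -(@coef_lead K (1, 1) _ F _ _ e) // z coef0.
Qed.

Lemma has_degI F d : degle (1, 1) d%:Z F -> lead (1, 1) d%:Z F != 0 -> has_deg F d.
Proof.
move=> dF; rewrite -lead_coef_eq0 lead_coefE => /lead_coef_point [//|j [jF e]].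
by split=> //; exists (mn (size (lead (1, 1) d%:Z F)).-1 j).
Qed.

Lemma has_deg_swap F d : has_deg F d -> has_deg (swap F) d.
Proof.
move=> [dF [v vF e]]; split; first exact: degle_swap.
exists (mn (v 1) (v 0)); first by rewrite msupp_swap mnE0 mnE1 mn_eta.
by rewrite wt_mn -e /wt /= addrC.
Qed.

Lemma has_deg_shear rho F d : has_deg F d -> has_deg (shear rho 1 F) d.
Proof.
move=> dF; have lF := has_deg_lead dF; apply: has_degI.
  by apply: degle_shear (proj1 dF).
rewrite lead_shear ?mul1r //; last exact: (proj1 dF).
by rewrite -size_poly_gt0 size_comp_poly2 ?size_poly_gt0 // size_XaddC.
Qed.

Lemma size_lead11 F d : (size (lead (1%R, 1%R) d%:Z F) <= d.+1)%N.
Proof.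
apply/leq_sizeP => i di; apply/eqP/negPn/negP => /coef_lead_neq0 [j].
by rewrite wt_mn /=; lia.
Qed.

(** The top form f has degree d > 0 in x if x^d occurs in it, so it has a root
rho. After x -> x + rho y it is divisible by x, that is, y^d does not occur; now
swap x and y. *)
Lemma avoid_x_power F G d d' : jacpair F G -> has_deg F d -> has_deg G d' ->
  (0 < d)%N -> exists F' G', [/\ jacpair F' G', has_deg F' d, has_deg G' d' &
    (lead (1, 1) d%:Z F')`_d = 0].
Proof.
move=> jFG dF dG d0.
have [z|nz] := eqVneq (lead (1, 1) d%:Z F)`_d 0; first by exists F, G.
have [rho rootF] : exists rho, root (lead (1, 1) d%:Z F) rho.
  apply/closed_rootP; rewrite neq_ltn; apply/orP; right.
  apply: (@leq_ltn_trans d) => //; rewrite ltnNge.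
  by apply: contraNN nz => /(nth_default 0) ->.
exists (swap (shear rho 1 F)), (swap (shear rho 1 G)); split.
- by apply: jacpair_swap; apply: jacpair_shear.
- by apply: has_deg_swap; apply: has_deg_shear.
- by apply: has_deg_swap; apply: has_deg_shear.
rewrite (@coef_lead_mn K (1, 1) _ _ d 0) ?wt_mn //=;
  last by rewrite mulr0 addr0 mul1r.
rewrite mcoeff_swap -(@coef_lead_mn K (1, 1) d%:Z) ?wt_mn //=;
  last by rewrite mulr0 add0r mul1r.
rewrite lead_shear ?mul1r //; last exact: (proj1 dF).
by rewrite -horner_coef0 horner_comp !hornerE; apply/rootP.
Qed.

(** When x^d does not occur in the top form, its degree in x is less than d,
which is the inequality required by [leading_form_power]. The conclusion m <> j
is (w.1 + w.2) m <> D, that is, 2 m <> m + j. *)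
Lemma two_points F G d d' : jacpair F G -> has_deg F d -> has_deg G d' ->
  (0 < d)%N -> (b * d = a * d')%N ->
  exists F' G' (m j m' j' : nat), [/\ jacpair F' G',
    top (1, 1) F' (mn m j) /\ top (1, 1) G' (mn m' j'),
    m <> j, (0 < j)%N /\ (m + j = d)%N & (b * m = a * m')%N /\ (b * j = a * j')%N].
Proof.
move=> jFG dF dG d0 ed.
have [F1 [G1 [jFG1 dF1 dG1 z]]] := avoid_x_power jFG dF dG d0.
have [d2 dd'] := ratio_ge2 ed d0.
have lF := has_deg_lead dF1; have lG := has_deg_lead dG1.
have sf : ((size (lead (1%R, 1%R) d%:Z F1)).-1 < d)%N.
  have := size_lead11 F1 d; rewrite leq_eqVlt => /orP [/eqP e|]; last by lia.
  by move: lF; rewrite -lead_coef_eq0 lead_coefE e z eqxx.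
have [||||rho [c [c' [m [m' [[c0 c'0] eF eG bm ne]]]]]] :=
  edge_powers jFG1 a0 (w := (1, 1)) isT isT _ _ (proj1 dF1) lF (proj1 dG1) lG
    (b := b) _ _.
- by rewrite ltz_nat.
- by rewrite /=; lia.
- by rewrite -!PoszM ed.
- by rewrite ltr_pM2l // ltz_nat.
have mono H e (k : K) i : degle (1, 1) e%:Z H -> k != 0 ->
    lead (1, 1) e%:Z H = k%:P * ('X - rho%:P) ^+ i ->
    exists j, (i + j = e)%N /\ top (1, 1) (shear rho 1 H) (mn i j).
  move=> dH k0 lH.
  have [||j [ej tj]] := @top_of_lead K (1, 1) e%:Z (shear rho 1 H) k i isT k0.
  - exact: degle_shear.
  - rewrite lead_shear ?mul1r // lH rmorphM rmorphXn /=.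
    by rewrite comp_polyC comp_polyB comp_polyX comp_polyC addrK.
  by exists j; split=> //; move: ej; rewrite wt_mn /= !mul1r -PoszD => -[].
have [j [ej tj]] := mono _ _ _ _ (proj1 dF1) c0 eF.
have [j' [ej' tj']] := mono _ _ _ _ (proj1 dG1) c'0 eG.
exists (shear rho 1 F1), (shear rho 1 G1), m, j, m', j'; split=> //.
- exact: jacpair_shear.
- by move=> e; move/eqP: ne; apply; rewrite -ej -e /= PoszD; ring.
- split=> //; move: sf; rewrite eF size_Cmul // size_exp_XsubC /= -ej; lia.
- split=> //; move: ed; rewrite -ej -ej' !mulnDr bm => /eqP.
  by rewrite eqn_add2l => /eqP.
Qed.

(** Induction on the degree d: the case m = 0 of [two_points], where the curve
F = 0 has a single point at infinity, leads to a pair of smaller degree, and the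
other case is settled by [corner_case]. *)
Theorem reduction d d' F G : jacpair F G -> has_deg F d -> has_deg G d' ->
  (b * d = a * d')%N -> exists F' G', normal_pair F' G'.
Proof.
elim/ltn_ind: d d' F G => d IH d' F G jFG dF dG ed.
have d0 : (0 < d)%N.
  rewrite lt0n; apply/eqP => dz; case: jFG => c c0.
  have z i : F^`M(i) = 0.
    apply/mpolyP => k; rewrite mcoeff_deriv mcoeff0 memN_msupp_eq0 ?mul0rn //.
    apply/negP => /(proj1 dF); rewrite dz /wt /= !mul1r !mnmDE !mnm1E.
    by case: i => -[|[|//]] ? /=; lia.
  rewrite /bracket !z mulr0 subr0 mul0r => /esym/eqP.
  by rewrite mpolyC_eq0 (negPf c0).
have [F1 [G1 [m [j [m' [j' [jFG1 [tF tG] mj [j0 mjd] [em ej]]]]]]]] :=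
  two_points jFG dF dG d0 ed.
have [m0|m0] := posnP m.
  have mz : m' = 0%N.
    move: em; rewrite m0 muln0 => /esym/eqP; rewrite muln_eq0.
    by move=> /orP [/eqP|/eqP //]; lia.
  rewrite m0 mz in tF tG.
  have [F2 [G2 [p [x [y [x' [y' [jFG2 [p2 x0] [tF2 tG2] [ex ey] e]]]]]]]] :=
    steep_case jFG1 tF tG j0 ej.
  have [F3 [G3 [s [t [s' [t' [jFG3 lt [sF dF3] [sG dG3] [es et]]]]]]]] :=
    descent jFG2 p2 x0 tF2 tG2 ex ey.
  apply: (IH (s + t)%N _ (s' + t')%N F3 G3) => //.
  - by rewrite -mjd m0 add0n -e.
  - split; last by exists (mn s t); rewrite // wt_mn /= !mul1r PoszD.
    by move: dF3; rewrite wt_mn /= !mul1r PoszD.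
  - split; last by exists (mn s' t'); rewrite // wt_mn /= !mul1r PoszD.
    by move: dG3; rewrite wt_mn /= !mul1r PoszD.
  by rewrite !mulnDr es et.
have [lt|gt|//] := ltngtP m j.
  exact: corner_case jFG1 tF tG m0 lt em ej.
exact: corner_case (jacpair_swap jFG1) (top_swap tF) (top_swap tG) j0 gt ej em.
Qed.
End Reduction.

(** * The substitution x + 1, x + y *)

Section Hat.
Variable K : numClosedFieldType.
Local Notation poly2 := {mpoly K[2]}.
Implicit Types (F G A B : poly2).

Definition hat F : poly2 := subst ('X_0 + 1) ('X_0 + 'X_1) F.

Lemma bracket_hat : bracket ('X_0 + 1) ('X_0 + 'X_1) = 1 :> poly2.
Proof.
rewrite bracketDr !(bracket_sym _ ('X_0 + 1)) !bracketDr !bracket_self.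
rewrite -mpolyC1 !bracketC.
by rewrite [bracket 'X_1 _]bracket_sym bracketX01 !addr0 oppr0 add0r opprK mpolyC1.
Qed.

Lemma lead_subst_top w u sx sy F v :
  top w F v -> degle u w.1 sx -> degle u w.2 sy ->
  lead u (wt w v) (subst sx sy F) =
    F@_v *: (lead u w.1 sx ^+ v 0 * lead u w.2 sy ^+ v 1).
Proof.
move=> tF dx dy; rewrite (lead_subst dx dy (top_degle tF)).
rewrite big_mkcond (bigD1_seq v) ?msupp_uniq //=; last exact: (proj1 tF).
rewrite eqxx big1_seq ?addr0 // => k /andP [kv kF].
by case: eqP => // e; have := proj2 tF k kF kv; rewrite e ltxx.
Qed.

Section Corner.
Variables (m n : nat) (F : poly2).
Hypothesis m0 : (0 < m)%N.
Hypothesis mn0 : (m < n)%N.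
Hypothesis cF : below_corner F m n.
Hypothesis F1 : F@_(mn m n) = 1.

Lemma corner_top w : w = (0, 1) \/ w = (1, 1) -> top w F (mn m n).
Proof.
move=> hw; case: cF => vF below; split=> // k kF kv.
have [k0 k1] := below k kF.
have [e0|e0] := eqVneq (k 0) m.
  have : k 1 <> n.
    by move=> e1; case/eqP: kv; apply: mnm2P; rewrite ?mnE0 ?mnE1.
  by case: hw => ->; rewrite wt_mn /wt /=; move: k0 k1; lia.
by case: hw => ->; rewrite wt_mn /wt /=; move: k0 k1 e0 => /=; lia.
Qed.

Let dx0 : degle (0, 1) 0 ('X_0 + 1 : poly2).
Proof. by apply: degleD; [exact: (@degleX0 K (0, 1)) | exact: degle1]. Qed.
Let dy0 : degle (0, 1) 1 ('X_0 + 'X_1 : poly2).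
Proof.
apply: degleD; last exact: (@degleX1 K (0, 1)).
exact: degle_le (@degleX0 K (0, 1)).
Qed.
Let dx1 : degle (1, 1) 1 ('X_0 + 1 : poly2).
Proof.
apply: degleD; [exact: (@degleX0 K (1, 1))|].
exact: degle_le (@degle1 K (1, 1)).
Qed.
Let dy1 : degle (1, 1) 1 ('X_0 + 'X_1 : poly2).
Proof.
by apply: degleD; [exact: (@degleX0 K (1, 1)) | exact: (@degleX1 K (1, 1))].
Qed.

Let t0 := corner_top (w := (0, 1)) (or_introl erefl).
Let t1 := corner_top (w := (1, 1)) (or_intror erefl).

Lemma lead01_hat : lead (0, 1) n%:Z (hat F) = ('X + 1) ^+ m.
Proof.
have := @lead_subst_top (0, 1) (0, 1) _ _ _ _ t0 dx0 dy0.
rewrite wt_mn /= mul0r mul1r add0r => ->.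
rewrite F1 scale1r mnE0 mnE1 !linearD /= (@leadX0 K (0, 1)) (@leadX1 K (0, 1)) lead1.
by rewrite (@lead_gt K (0, 1) 0) ?add0r ?expr1n ?mulr1 //; exact: (@degleX0 K (0, 1)).
Qed.

Lemma lead11_hat : lead (1, 1) (m + n)%:Z (hat F) = 'X ^+ m * ('X + 1) ^+ n.
Proof.
have := @lead_subst_top (1, 1) (1, 1) _ _ _ _ t1 dx1 dy1.
rewrite wt_mn /= !mul1r -PoszD => ->.
rewrite F1 scale1r mnE0 mnE1 !linearD /= (@leadX0 K (1, 1)) (@leadX1 K (1, 1)).
by rewrite (@lead_gt K (1, 1) 0 1) ?addr0 //; exact: degle1.
Qed.

Lemma supp_hat k : k \in msupp (hat F) ->
  (k 1%R <= n)%N /\ (k 0%R + k 1%R <= m + n)%N.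
Proof.
move=> kH; split.
  have := @degle_subst K (0, 1) (0, 1) _ _ dx0 dy0 _ _ (top_degle t0) k kH.
  by rewrite wt_mn /wt /= !mul0r !mul1r !add0r.
have := @degle_subst K (1, 1) (1, 1) _ _ dx1 dy1 _ _ (top_degle t1) k kH.
by rewrite wt_mn /wt /= !mul1r -!PoszD.
Qed.

Lemma hat_corners : [/\ (hat F)@_(mn 0 n) = 1, (hat F)@_(mn m n) = 1 &
  (hat F)@_(mn (m + n) 0) = 1].
Proof.
have c0 i : (('X + 1) ^+ i : {poly K})`_0 = 1.
  by rewrite -horner_coef0 horner_exp !hornerE expr1n.
have ci i : (('X + 1) ^+ i : {poly K})`_i = 1.
  have e : 'X + 1 = 'X - (-1)%:P :> {poly K} by rewrite rmorphN /= opprK.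
  have := lead_coef_exp ('X + 1 : {poly K}) i.
  rewrite lead_coefE e size_exp_XsubC /= => ->.
  by rewrite lead_coefXsubC expr1n.
split.
- rewrite -(@coef_lead_mn K (0, 1) n%:Z) ?lead01_hat //.
  by rewrite wt_mn /= mulr0 mul1r add0r.
- rewrite -(@coef_lead_mn K (0, 1) n%:Z) ?lead01_hat //.
  by rewrite wt_mn /= mul0r mul1r add0r.
rewrite -(@coef_lead_mn K (1, 1) (m + n)%:Z) ?lead11_hat //; last first.
  by rewrite wt_mn /= mulr0 mul1r addr0.
by rewrite coefXnM ltnNge leq_addr /= addKn.
Qed.

(** On monomials B the product A B is homogeneous, so its part of degree j is A B
or 0. *)
Lemma divides_pihomog (mf : measure 2) d j A B : A \is d.-homog for mf ->
  exists h, pihomog mf j (A * B) = h * A.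
Proof.
move=> hA; elim/mpoly_linear_ind: B => [k|c B C [h eB] [g eC]].
  have hk : A * 'X_[k] \is (d + mf k).-homog for mf by rewrite dhomogM // dhomogX.
  have [->|ne] := eqVneq j (d + mf k)%N.
    by exists 'X_[k]; rewrite pihomog_dE // mulrC.
  by exists 0; rewrite mul0r (pihomog_ne0 _ hk) // eq_sym.
exists (c *: h + g); rewrite mulrDr -scalerAr linearP /= eB eC.
by rewrite mulrDl scalerAl.
Qed.

Lemma pihomog_lt (mf : measure 2) j B :
  {in msupp B, forall k, (mf k < j)%N} -> pihomog mf j B = 0.
Proof.
move=> lt; rewrite pihomogE big1_seq // => k /andP [/eqP e /lt].
by rewrite e ltnn.
Qed.

Lemma divides_hat (mf : measure 2) j A s :
  (forall k, k \in msupp F -> exists h,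
     pihomog mf j (('X_0 + 1) ^+ k 0 * ('X_0 + 'X_1) ^+ k 1) = h * A ^+ s) ->
  exists h, pihomog mf j (hat F) = h * A ^+ s.
Proof.
move=> each.
rewrite (mpolyE F) /hat subst_sum (linear_sum (pihomog mf j)) /= big_seq.
elim/big_ind: _ => [|x y [h ->] [g ->]|k kF].
- by exists 0; rewrite mul0r.
- by exists (h + g); rewrite mulrDl.
have [h e] := each k kF; exists (F@_k *: h).
by rewrite substZ linearZ /= substX e scalerAl.
Qed.

(** In (x + 1)^p (x + y)^q the first factor has y-degree 0, so it divides every
part. If p < m - i, then q <= n - m + p < n - i, and there is no part of y-degree
n - i. *)
Lemma part01_hat i : (i <= m)%N ->
  exists h, pihomog ydeg (n - i) (hat F) = h * ('X_0 + 1) ^+ (m - i).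
Proof.
move=> im; apply: divides_hat => k kF; have [k0 k1] := proj2 cF k kF.
have [le|lt] := leqP (m - i) (k 0).
  have hA : ('X_0 + 1 : poly2) ^+ k 0 \is (0 * k 0%R)%N.-homog for ydeg.
    by apply: dhomogMn; rewrite rpredD ?dhomog1 // dhomogX /= /ydeg mnm1E.
  have [h ->] := divides_pihomog (n - i) (('X_0 + 'X_1) ^+ k 1) hA.
  exists (h * ('X_0 + 1) ^+ (k 0 - (m - i))).
  by rewrite -mulrA -exprD subnK.
exists 0; rewrite mul0r; apply: pihomog_lt => l.
move/(degleM (degleXn dx0) (degleXn dy0)).
rewrite /wt /ydeg /= !mul0r !mul1r !add0r lez_nat => lk.
by apply: leq_ltn_trans lk _; move: k0 k1 lt => /=; lia.
Qed.

(** As for [part01_hat], the factor (x + y)^q being homogeneous. If q < n - i,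
then p + q < m + n - i as p <= m. *)
Lemma part11_hat i : (i <= n)%N ->
  exists h, pihomog mdeg (m + n - i) (hat F) = h * ('X_0 + 'X_1) ^+ (n - i).
Proof.
move=> im; apply: divides_hat => k kF; have [k0 k1] := proj2 cF k kF.
have [le|lt] := leqP (n - i) (k 1).
  have hA : ('X_0 + 'X_1 : poly2) ^+ k 1 \is (1 * k 1%R)%N.-homog for mdeg.
    by apply: dhomogMn; rewrite rpredD // dhomogX /= mdeg1.
  have [h e] := divides_pihomog (m + n - i) (('X_0 + 1) ^+ k 0) hA.
  exists (h * ('X_0 + 'X_1) ^+ (k 1 - (n - i))).
  by rewrite mulrC e -mulrA -exprD subnK.
exists 0; rewrite mul0r; apply: pihomog_lt => l.
move/(degleM (degleXn dx1) (degleXn dy1)).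
rewrite /wt /= !mul1r -!PoszD lez_nat -mdeg2 => lk.
by apply: leq_ltn_trans lk _; move: k0 k1 lt => /=; lia.
Qed.
End Corner.
End Hat.

(** * Newton polygons *)

Section Hulls.
Local Open Scope classical_set_scope.
Local Open Scope ring_scope.
Variable R : realType.
Local Notation plane := (R^o * R^o)%type.
Implicit Types (A C : set plane).

Lemma convexP C : @convex_set R plane C <->
  forall (x y : plane) (t : R), C x -> C y -> 0 <= t -> t <= 1 -> C (t *: x + (1 - t) *: y).
Proof.
split=> [cC x y t Cx Cy t0 t1|cC x y t].
  by have := cC x y (Itv01 t0 t1) (mem_set Cx) (mem_set Cy) => /set_mem.
move=> /set_mem Cx /set_mem Cy; apply/mem_set; exact: cC.
Qed.

Lemma convex_hull A : @convex_set R plane (conv_hull A).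
Proof.
apply/convexP => x y t Ax Ay t0 t1 C [cC AC].
by move/convexP: (cC); apply=> //; [apply: Ax | apply: Ay].
Qed.

Lemma convex_half (u v c : R) :
  @convex_set R plane [set p | u * p.1 + v * p.2 <= c].
Proof.
apply/convexP => -[x1 x2] [y1 y2] t /= hx hy t0 t1.
have e : u * (t * x1 + (1 - t) * y1) + v * (t * x2 + (1 - t) * y2) =
  t * (u * x1 + v * x2) + (1 - t) * (u * y1 + v * y2) by ring.
have := ler_wpM2l t0 hx; have := @ler_wpM2l _ (1 - t) _ _ _ hy.
rewrite subr_ge0 => /(_ t1) h1 h2.
rewrite -[_ *: x1]/(t * x1) -[_ *: x2]/(t * x2) -[_ *: y1]/((1 - t) * y1).
rewrite -[_ *: y2]/((1 - t) * y2).
change (u * (t * x1 + (1 - t) * y1) + v * (t * x2 + (1 - t) * y2) <= c).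
rewrite e; apply: le_trans (lerD h2 h1) _.
by rewrite -mulrDl addrC subrK mul1r.
Qed.

Lemma convexI A C : @convex_set R plane A -> @convex_set R plane C ->
  @convex_set R plane (A `&` C).
Proof.
move=> /convexP cA /convexP cC; apply/convexP => x y t [Ax Cx] [Ay Cy] t0 t1.
by split; [apply: cA | apply: cC].
Qed.

Lemma trapezoid_halves (x y c d : R) : 0 <= y <= c /\ 0 <= x <= d - y <->
  (-1) * x + 0 * y <= 0 /\ 0 * x + (-1) * y <= 0 /\
  0 * x + 1 * y <= c /\ 1 * x + 1 * y <= d.
Proof.
split=> [[/andP[h1 h2] /andP [h3 h4]]|[h1 [h2 [h3 h4]]]].
  by split; [|split; [|split]]; lra.
by split; apply/andP; split; lra.
Qed.

Lemma convex_trapezoid (m n : int) : @convex_set R plane (trapezoid m n).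
Proof.
have -> : trapezoid m n = [set p | (-1) * p.1 + 0 * p.2 <= 0] `&`
    ([set p | 0 * p.1 + (-1) * p.2 <= 0] `&`
    ([set p | 0 * p.1 + 1 * p.2 <= n%:~R] `&`
     [set p | 1 * p.1 + 1 * p.2 <= (m + n)%:~R])) :> set plane.
  by apply/seteqP; split=> -[x y] /trapezoid_halves.
by do ![apply: convexI]; apply: convex_half.
Qed.

Lemma convex_segment C (x1 x2 y1 y2 t z1 z2 : R) : @convex_set R plane C ->
  C (x1, x2) -> C (y1, y2) -> 0 <= t -> t <= 1 ->
  z1 = t * x1 + (1 - t) * y1 -> z2 = t * x2 + (1 - t) * y2 -> C (z1, z2).
Proof. by move=> /convexP cC Cx Cy t0 t1 -> ->; exact: cC Cx Cy t0 t1. Qed.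

(** The horizontal section of the trapezoid at height y joins (0, y), which lies
between the corners on the left side, to (m + n - y, y), which lies between those
on the right side. *)
Lemma trapezoid_sub (m n : nat) C : (0 < m)%N -> (0 < n)%N ->
  @convex_set R plane C ->
  C (lattice_pt R 0 0) -> C (lattice_pt R 0 n) -> C (lattice_pt R m n) ->
  C (lattice_pt R (m + n) 0) -> trapezoid m n `<=` C.
Proof.
move=> m0 n0 cC c00 c0n cmn cm0 [x y] [/= /andP [y0 yn] /andP [x0 xy]].
have mR : 0 < m%:R :> R by rewrite ltr0n.
have nR : 0 < n%:R :> R by rewrite ltr0n.
rewrite -[n%:~R]/(n%:R) in yn.
rewrite -PoszD -[(_%:Z)%:~R]/((m + n)%:R) natrD in xy.
rewrite /lattice_pt natrD in cm0.
have t0 : 0 <= y / n%:R by rewrite divr_ge0 ?ler0n.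
have t1 : y / n%:R <= 1 by rewrite ler_pdivrMr // mul1r.
have left : C (0, y).
  apply: (convex_segment (t := y / n%:R) cC c0n c00) => //; first by ring.
  by field; rewrite gt_eqF.
have right : C (m%:R + n%:R - y, y).
  apply: (convex_segment (t := y / n%:R) cC cmn cm0) => //.
    by field; rewrite gt_eqF.
  by field; rewrite gt_eqF.
have l0 : 0 < m%:R + n%:R - y by lra.
apply: (convex_segment (t := x / (m%:R + n%:R - y)) cC right left).
- by rewrite divr_ge0 // ltW.
- by rewrite ler_pdivrMr // mul1r.
- by field; rewrite gt_eqF.
by field; rewrite gt_eqF.
Qed.

Local Notation poly2 := {mpoly R[i][2]}.

Lemma newton0_sub (H : poly2) C : @convex_set R plane C -> C (lattice_pt R 0 0) ->
  (forall k, k \in msupp H -> C (lattice_pt R (k 0) (k 1))) -> newton0 H `<=` C.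
Proof.
move=> cC c0 cH; rewrite /newton0; case: eqP => _; first exact: sub0set.
apply: smallest_sub => [|p]; first exact: cC.
by case=> [[k kH <-]|->]; [exact: cH | exact: c0].
Qed.

Lemma newton0_supp (H : poly2) i j :
  H@_(mn i j) != 0 -> newton0 H (lattice_pt R i j).
Proof.
rewrite -mcoeff_msupp => kH; rewrite /newton0; case: eqP kH => [->|_ kH].
  by rewrite msupp0 in_nil.
apply: sub_gen_smallest; left; exists (mn i j) => //.
Qed.

Lemma newton0_origin (H : poly2) : H != 0 -> newton0 H (lattice_pt R 0 0).
Proof.
by rewrite /newton0 => /negPf ->; apply: sub_gen_smallest; right.
Qed.

Lemma newton0_convex (H : poly2) : @convex_set R plane (newton0 H).
Proof.
rewrite /newton0; case: ifP => _; last exact: convex_hull.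
by move=> x y t /set_mem.
Qed.

Section Hat.
Variables (m n : nat) (F : poly2).
Hypothesis m0 : (0 < m)%N.
Hypothesis mn0 : (m < n)%N.
Hypothesis cF : below_corner F m n.
Hypothesis F1 : F@_(mn m n) = 1.

Lemma trapezoidE i j :
  trapezoid m n (lattice_pt R i j) <-> (j <= n /\ i + j <= m + n)%N.
Proof.
rewrite /trapezoid /lattice_pt /=.
rewrite -[n%:~R]/(n%:R) -PoszD -[(_%:Z)%:~R]/((m + n)%:R) !ler0n /= ler_nat.
by rewrite lerBrDr -natrD ler_nat.
Qed.

Lemma newton0_hat : newton0 (hat F) = trapezoid m n.
Proof.
have [c0n cmn cm0] := hat_corners m0 mn0 cF F1.
apply/seteqP; split.
  apply: newton0_sub; first exact: convex_trapezoid.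
    by apply/trapezoidE.
  by move=> k /(supp_hat m0 mn0 cF) [k1 k0]; apply/trapezoidE.
have ne i j : (hat F)@_(mn i j) = 1 -> newton0 (hat F) (lattice_pt R i j).
  by move=> e; apply: newton0_supp; rewrite e oner_neq0.
apply: trapezoid_sub (ne _ _ c0n) (ne _ _ cmn) (ne _ _ cm0) => //.
- exact: leq_ltn_trans mn0.
- exact: newton0_convex.
apply: newton0_origin; apply: contra_eq_neq c0n => ->.
by rewrite mcoeff0 eq_sym oner_neq0.
Qed.

(** The functional p.1 + 2 p.2 takes its maximum m + 2 n over the lattice points
of the trapezoid at (m, n) only. Subtracting x^m y^n removes this point, and the
hull stays in the half-plane where the functional is at most m + 2 n - 1. *)
Lemma newton0_hat_sub :
  newton0 (hat F - 'X_0 ^+ m * 'X_1 ^+ n) `<` newton0 (hat F).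
Proof.
have [c0n cmn cm0] := hat_corners m0 mn0 cF F1.
have eX : 'X_0 ^+ m * 'X_1 ^+ n = 'X_[mn m n] :> poly2
  by rewrite [RHS]mpolyX2 mnE0 mnE1.
rewrite newton0_hat eX.
pose C : set plane := trapezoid m n `&`
  [set p | 1 * p.1 + 2 * p.2 <= (m + 2 * n)%:R - 1].
have sub : newton0 (hat F - 'X_[mn m n]) `<=` C.
  apply: newton0_sub.
  - by apply: convexI; [exact: convex_trapezoid | exact: convex_half].
  - split; first by apply/trapezoidE.
    by rewrite /lattice_pt /= !mulr0 addr0 subr_ge0 ler1n; move: m0; lia.
  move=> k kH; have kmn : k != mn m n.
    apply: contraTneq kH => ->; rewrite mcoeff_msupp mcoeffB cmn mcoeffX eqxx.
    by rewrite subrr eqxx.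
  have kF : k \in msupp (hat F).
    move: kH; rewrite !mcoeff_msupp mcoeffB mcoeffX [_ == k]eq_sym.
    by rewrite (negPf kmn) subr0.
  have [k1 k0] := supp_hat m0 mn0 cF kF; split; first by apply/trapezoidE.
  have lt : (k 0%R + 2 * k 1%R < m + 2 * n)%N.
    have : k 0 <> m \/ k 1 <> n.
      have [e0|/eqP ne] := eqVneq (k 0) m; [right=> e1 | by left].
      by case/eqP: kmn; apply: mnm2P; rewrite ?mnE0 ?mnE1.
    by move: k1 k0 => /=; lia.
  rewrite /lattice_pt /= mul1r lerBrDr -natrM -natrD -[1]/(1%:R) -natrD ler_nat.
  by rewrite addn1.
split=> [p /sub []//|all].
have : newton0 (hat F - 'X_[mn m n]) (lattice_pt R m n) by apply/all/trapezoidE.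
move/sub => [_]; rewrite /lattice_pt /= natrD natrM; lra.
Qed.

End Hat.
End Hulls.

Lemma divn_ratio a b m m' : (0 < a)%N -> (b * m = a * m')%N -> (b * m %/ a)%N = m'.
Proof. by move=> a0 ->; rewrite mulKn. Qed.

Theorem lemma3p2 (R : realType) : assertionB R -> assertionA R.
Proof.
move=> B a b a0 b0 cop /andP [a2 ab] F G [c eJ] _ _ eT.
have [c0|c0] := eqVneq c 0; first by rewrite eJ c0 mpolyC0.
have jFG : jacpair F G by exists c.
have hd (H : {mpoly R[i][2]}) : H != 0 -> has_deg H (tdeg H).
  move=> H0; have sH : (msize H = (tdeg H).+1)%N.
    by rewrite /tdeg prednK // lt0n msize_poly_eq0.
  split.
    move=> k /msize_mdeg_lt; rewrite sH ltnS mdeg2 /wt /= => le.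
    by rewrite !mul1r -PoszD lez_nat.
  exists (mlead H); first exact: mlead_supp.
  have := mlead_deg H0; rewrite sH mdeg2 => -[] <-.
  by rewrite /wt /= !mul1r PoszD.
have F0 : F != 0.
  apply: contraNneq c0 => F0; move/eqP: eJ.
  by rewrite /jac F0 !mderiv0 mul0r mulr0 subrr eq_sym mpolyC_eq0.
have G0 : G != 0.
  apply: contraNneq c0 => G0; move/eqP: eJ.
  by rewrite /jac G0 !mderiv0 mul0r mulr0 subrr eq_sym mpolyC_eq0.
have eT' : (b * tdeg F = a * tdeg G)%N by rewrite mulnC eT mulnC.
have [F' [G' [m [n [m' [n' [jFG' [m0 mn0] [em en] cF cG]]]]]]] :=
  reduction a2 ab cop jFG (hd F F0) (hd G G0) eT'.
exfalso.
have m0' : (0 < m')%N by have [] := ratio_ge2 a2 ab cop em m0; lia.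
have mn0' := ratio_lt a2 ab em en mn0.
have norm (H : {mpoly R[i][2]}) i j : below_corner H i j ->
    exists d, [/\ d != 0, below_corner (d *: H) i j & (d *: H)@_(mn i j) = 1].
  move=> [vH sH]; have h0 : H@_(mn i j) != 0 by rewrite -mcoeff_msupp.
  exists (H@_(mn i j))^-1; rewrite invr_eq0.
  split=> //; last by rewrite mcoeffZ mulVf.
  split; first by rewrite mcoeff_msupp mcoeffZ mulVf // oner_neq0.
  by move=> k /msuppZ_le /sH.
have [d [d0 cF1 F1]] := norm _ _ _ cF.
have [d' [d'0 cG1 G1]] := norm _ _ _ cG.
have [c1 c10 eJ1] := jFG'.
have eJ2 : jac (hat (d *: F')) (hat (d' *: G')) = (d * (d' * c1))%:MP.
  rewrite -[LHS]/(bracket _ _) bracket_subst bracket_hat mulr1.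
  rewrite bracketZl bracketZr eJ1.
  by rewrite -!mul_mpolyC -!mpolyCM substC.
have dvd k k' : (b * k = a * k')%N -> (a %| k)%N.
  by move=> e; rewrite -(Gauss_dvdr _ cop) e dvdn_mulr.
have : jac (hat (d *: F')) (hat (d' *: G')) = 0.
  have inQ_abmn : inQ a b m n.
    split=> //; [|by split; apply: dvd; [exact: em|exact: en]|by rewrite a2].
    by rewrite a0 b0 m0 (leq_ltn_trans _ mn0).
  apply: (B a b m n inQ_abmn).
  - exact: newton0_hat.
  - exact: newton0_hat_sub.
  - by move=> i im; exact: (part01_hat m0 mn0 cF1 im).
  - by move=> i im; exact: (part11_hat m0 mn0 cF1 im).
  - by rewrite !(divn_ratio a0 em, divn_ratio a0 en); exact: newton0_hat.
  - by rewrite !(divn_ratio a0 em, divn_ratio a0 en); exact: newton0_hat_sub.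
  - by exists (d * (d' * c1)).
rewrite eJ2 => /eqP; rewrite mpolyC_eq0 !mulf_eq0.
by rewrite (negPf d0) (negPf d'0) (negPf c10).
Qed.
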